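(* Let $p$ be an odd integer, and let $A_p=a_1a_2a_3\cdots$ be an infinite sequence with $a_k\in\{-p,p\}$ for all $k\ge1$. Put $$\Lambda(A_p)=\left\{\sum_{k=1}^n4^{k-1}\omega_k:\ \omega_k\in\{0,a_k\},\ n\ge1\right\}.$$ Then $\Lambda(A_p)$ is not a spectrum for the measure $\mu_4$ if and only if there is an integer $\lambda$ whose quasi $4$-based expansion with respect to $A_p$ is infinite and ultimately periodic; namely, there exist an integer $\lambda$ and an ultimately periodic sequence $\omega_1\omega_2\omega_3\cdots\in\{-p,0,p\}^\infty$, not ending in $0^\infty$, with $\omega_k\in\{0,a_k\}$ for all $k\ge1$, such that $$\lambda\equiv\sum_{k=1}^n4^{k-1}\omega_k\pmod{4^n}\qquad\text{for all } n\in\mathbb{N}.$$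
   Context: $\mu_4$ denotes the middle-fourth Cantor measure: the unique Borel probability measure on $\mathbb{R}$ satisfying $\mu_4(\cdot)=\frac12\mu_4\circ\tau_1^{-1}(\cdot)+\frac12\mu_4\circ\tau_2^{-1}(\cdot)$, where $\tau_1(x)=4^{-1}x$ and $\tau_2(x)=4^{-1}(x+2)$. A discrete set $\Lambda\subseteq\mathbb{R}$ is a spectrum for a Borel probability measure $\mu$ on $\mathbb{R}$ if the family $\{e^{2\pi i\lambda x}:\lambda\in\Lambda\}$ is an orthonormal basis of $L^2(\mu)$. An infinite sequence is ultimately periodic if it has the form $uv^\infty=uvvv\cdots$ for finite words $u,v$ with $v$ nonempty. A sequence ends in $0^\infty$ if all but finitely many of its entries are $0$. *)

(* Defs.v *)
From HB Require Import structures.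
From mathcomp Require Import all_boot all_order all_algebra.
From mathcomp Require Import complex.
From mathcomp Require Import all_classical all_reals all_analysis.
Import Order.TTheory GRing.Theory Num.Theory.
Import numFieldNormedType.Exports.

Set Implicit Arguments.
Unset Strict Implicit.
Unset Printing Implicit Defensive.

Local Open Scope classical_set_scope.
Local Open Scope ring_scope.
Local Open Scope complex_scope.

(* The libraries put no sigma-algebra or norm over R on R[i], so measurability
   and integration are taken componentwise, and the L^2 norm of f is the
   library's real L^2 norm of the modulus |f|. *)

Section ComplexL2.
Context d (T : measurableType d) (R : realType).
Variable mu : {measure set T -> \bar R}.
Implicit Types f g : T -> R[i].

Definition cmeasurable f :=
  measurable_fun [set: T] (fun x => complex.Re (f x)) /\
  measurable_fun [set: T] (fun x => complex.Im (f x)).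

Definition L2norm f : \bar R :=
  'N[mu]_2%:E[EFin \o (fun x => ComplexField.Normc.normc (f x))].

Definition L2 : set (T -> R[i]) :=
  [set f | cmeasurable f /\ (L2norm f < +oo)%E].

Definition cintegral f : R[i] :=
  (\int[mu]_x complex.Re (f x)) +i* (\int[mu]_x complex.Im (f x)).

Definition L2inner f g : R[i] := cintegral (fun x => f x * (g x)^*).

(* A family (e i), i in D, is an orthonormal basis when it is orthonormal and
   its linear span (finite linear combinations) is dense. Functions equal
   almost everywhere are not identified: all conditions are invariant under
   that identification. *)
Definition orthonormal_family (I : choiceType) (D : set I)
    (e : I -> T -> R[i]) :=
  (forall i, D i -> L2 (e i)) /\
  (forall i j, D i -> D j -> L2inner (e i) (e j) = (i == j)%:R).

Definition dense_span (I : choiceType) (D : set I) (e : I -> T -> R[i]) :=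
  forall f, L2 f -> forall eps : R, 0 < eps ->
    exists (s : seq I) (c : I -> R[i]), [set` s] `<=` D /\
      (L2norm (fun x => f x - \sum_(i <- s) c i * e i x)%R < eps%:E)%E.

Definition orthonormal_basis (I : choiceType) (D : set I)
    (e : I -> T -> R[i]) :=
  orthonormal_family D e /\ dense_span D e.

End ComplexL2.

Section Spectrum.
Context (R : realType).
Implicit Types (mu : probability (measurableTypeR R) R) (Lam : set R).

(* exp(2 pi i lam x) *)
Definition expi (lam : R) (x : measurableTypeR R) : R[i] :=
  cos (2 * pi * lam * x) +i* sin (2 * pi * lam * x).

Definition discrete_set Lam := isolated Lam = Lam.

Definition is_spectrum mu Lam :=
  discrete_set Lam /\ orthonormal_basis mu Lam expi.

Definition tau1 (x : measurableTypeR R) : measurableTypeR R := 4^-1 * (x : R).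
Definition tau2 (x : measurableTypeR R) : measurableTypeR R :=
  4^-1 * ((x : R) + 2).

(* By Hutchinson's theorem exactly one probability measure satisfies this. *)
Definition middle_fourth_cantor_measure mu :=
  forall A : set (measurableTypeR R), measurable A ->
    mu A = ((2^-1)%:E * pushforward mu tau1 A
            + (2^-1)%:E * pushforward mu tau2 A)%E.

End Spectrum.

(* Sequences are indexed from 0: [a k] and [w k] stand for the entries written
   a_{k+1} and omega_{k+1} when indexing starts from 1. *)

Definition Lambda (R : realType) (a : nat -> int) : set R :=
  [set x | exists (n : nat) (w : nat -> int),
    [/\ (0 < n)%N,
        forall k, (k < n)%N -> w k = 0 \/ w k = a k &
        x = (\sum_(0 <= k < n) 4 ^+ k * w k)%:~R]].
Arguments Lambda : clear implicits.

Definition quasi4_expansion (a : nat -> int) (lam : int) (w : nat -> int) :=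
  (forall k, w k = 0 \/ w k = a k) /\
  (forall n : nat,
     (lam = \sum_(0 <= k < n) 4 ^+ k * w k %[mod 4 ^+ n])%Z).

(* w = u v v v ... with v nonempty *)
Definition ultimately_periodic (w : nat -> int) :=
  exists u v : seq int, (0 < size v)%N /\
    forall k, w k = if (k < size u)%N then u`_k
                    else v`_((k - size u) %% size v).

Definition ends_in_zeros (w : nat -> int) :=
  exists N : nat, forall k, (N <= k)%N -> w k = 0.

(* Main.v *)
From HB Require Import structures.
Require Import Defs.
From mathcomp Require Import all_boot all_order all_algebra finmap complex.
From mathcomp Require Import all_classical all_reals all_analysis measurable_realfun.
From mathcomp Require Import zify ring lra.
Import Order.TTheory GRing.Theory Num.Theory.
Import numFieldNormedType.Exports.
Local Open Scope ring_scope.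

(** Write [power t] for the squared modulus of the Fourier transform of mu4.
Self-similarity gives [power t = cos^2 (pi t / 2) power (t / 4)], so the
transform vanishes at every [4 ^ j (2 m + 1)]. Two integers with different
expansions differ by such a number (first differing digit,
[expansion_neq]), hence the exponentials with frequency in Lambda are
orthonormal; and an integer whose expansion does not end in zeros gives one
more exponential orthogonal to all of them, so that Lambda is not a spectrum
([orthogonal_not_dense]).

For the converse, Bessel's identity says that the squared distance from
[expi t] to the span of the exponentials of Lambda is the defect
[1 - sum_l power (t - l)]. Splitting Lambda by the first digit, with
[sin^2 (pi t / 2) = cos^2 (pi (t - a) / 2)] for odd a, shows that the defect is
harmonic for the walk which sends t to [t / 4] with probability
[cos^2 (pi t / 2)] and to [(t - a_k) / 4] otherwise. This walk stays in a
bounded interval. Let S be the supremum of the defect over that interval and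
all levels, and suppose that S > 0. At a point where the defect nearly
equals S, all branches of non-negligible weight have defect close to S. But a
long run of digits 0 leads close to 0, where the defect is at most [S / 2];
so that run must have small weight, which forces the point to be close to a
nonzero integer ([zeros_weight_small]). By harmonicity one of the two
successors again has defect nearly S, so there is an infinite path along
which the walk is always close to nonzero integers N_k. These satisfy
[N_k = w_k + 4 N_(k+1)], are bounded, and each determines the next, because an
odd N_k forces w_k = a_k and the sign of a_k is visible modulo 4. Hence N_0
has an infinite, ultimately periodic expansion ([defect_expansion]).

If there is no such expansion, then every defect vanishes and the closed span
of the exponentials of Lambda contains all the exponentials, that is, all
trigonometric polynomials with real frequencies. Those are dense
([L2_spanned]): mu4 lives on a bounded interval; there, iterating a cubic that
pushes [-1, 1] towards its endpoints turns sin (th (x - c)) into the sign of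
x - c; the indicators of rays thus belong to the closed span, then those of
all Borel sets, and finally all of L^2. *)

(** * Expansions of integers *)

(** The successive quotients N_k = (N_0 - sum_(j < k) 4^j w_j) / 4^k left over
when the digits w of N_0 are peeled off one at a time. *)
Definition residuals (N w : nat -> int) := forall k, N k = w k + 4 * N k.+1.

Lemma residuals_sum N w n : residuals N w ->
  N 0%N = \sum_(0 <= k < n) 4 ^+ k * w k + 4 ^+ n * N n.
Proof.
move=> hN; elim: n => [|n IHn]; first by rewrite big_nil expr0 mul1r add0r.
by rewrite big_nat_recr //= IHn {1}hN exprS; ring.
Qed.

(** The congruences modulo all powers of 4 amount to the existence of an orbit
of the map N |-> (N - w_k) / 4 inside the integers; this is the form in which
expansions are built and compared. *)
Lemma quasi4_expansionP (a : nat -> int) lam w : quasi4_expansion a lam w <->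
  (forall k, w k = 0 \/ w k = a k) /\ exists2 N, residuals N w & N 0%N = lam.
Proof.
have ndvd N : (0 : int) < 4 ^+ N by rewrite exprn_gt0.
split=> -[hw hlam]; split=> //.
  exists (fun n => ((lam - \sum_(0 <= k < n) (4 ^+ k * w k)%R) %/ 4 ^+ n)%Z).
    move=> n.
    have [q eq] : exists q, lam - \sum_(0 <= k < n.+1) 4 ^+ k * w k = q * 4 ^+ n.+1.
      by apply/dvdzP; rewrite -eqz_mod_dvd; apply/eqP; apply: hlam.
    rewrite eq mulzK ?gt_eqF //.
    have -> : lam - \sum_(0 <= k < n) 4 ^+ k * w k = (w n + 4 * q) * 4 ^+ n.
      move: eq; rewrite big_nat_recr //= exprS opprD addrA => /eqP.
      by rewrite subr_eq => /eqP ->; ring.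
    by rewrite mulzK ?gt_eqF.
  by rewrite big_nil subr0 expr0 divz1.
move=> n; have [N hN <-] := hlam; rewrite (residuals_sum _ _ n hN).
by apply/eqP; rewrite eqz_mod_dvd addrC addKr dvdz_mulr.
Qed.

Lemma odd_int (p : int) : odd `|p|%N -> exists s, p = 2 * s + 1.
Proof.
move=> hp; exists (if 0 <= p then (`|p|%N./2)%:Z else - (`|p|%N./2)%:Z - 1).
by case: ifP; lia.
Qed.

(** The difference is divisible by every power of 4. *)
Lemma expansion_eq {a l l' w w'} : quasi4_expansion a l w ->
  quasi4_expansion a l' w' -> w =1 w' -> l = l'.
Proof.
move=> /quasi4_expansionP[_ [N hN <-]] /quasi4_expansionP[_ [N' hN' <-]] ww'.
have e n : N 0%N - N' 0%N = 4 ^+ n * (N n - N' n).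
  rewrite (residuals_sum _ _ n hN) (residuals_sum _ _ n hN').
  by rewrite (eq_bigr (fun k => 4 ^+ k * w' k)) => [|k _]; [ring|rewrite ww'].
apply/eqP; rewrite -subr_eq0 -absz_eq0; apply/negPn/negP => n0.
have := ltn_expl `|N 0%N - N' 0%N| (isT : 1 < 4)%N.
rewrite ltnNge [leqRHS](congr1 absz (e `|N 0%N - N' 0%N|%N)) abszM abszX.
rewrite leq_pmulr // lt0n absz_eq0.
by apply: contra n0 => /eqP q0; rewrite (e `|N 0%N - N' 0%N|%N) q0 mulr0.
Qed.

(** At the first place j where the expansions differ, one digit is 0 and the other
is odd; the later digits contribute multiples of 4^(j+1). *)
Lemma expansion_neq {p a l l' w w' k} : odd `|p|%N ->
  (forall k, a k = - p \/ a k = p) ->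
  quasi4_expansion a l w -> quasi4_expansion a l' w' -> w k != w' k ->
  exists j m, l - l' = 4 ^+ j * (2 * m + 1).
Proof.
move=> /odd_int[s ->] ha.
move=> /quasi4_expansionP[hw [N hN <-]] /quasi4_expansionP[hw' [N' hN' <-]] wk.
have ex : exists j, w j != w' j by exists k.
case: (ex_minnP ex) => j wj jmin {k wk}.
have [r er] : exists r, w j - w' j = 2 * r + 1.
  exists ((w j - w' j - 1) %/ 2)%Z.
  by have [] := ha j; have [] := hw j; have [] := hw' j; move: wj => /eqP; lia.
exists j, (r + 2 * (N j.+1 - N' j.+1)).
rewrite (residuals_sum _ _ j hN) (residuals_sum _ _ j hN').
rewrite (eq_big_nat _ _ (F2 := fun k => 4 ^+ k * w' k)) => [|i /andP[_ ij]].
  by rewrite hN hN' -(subrK (w' j) (w j)) er; ring.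
by congr (_ * _); apply/eqP/negPn/negP => /jmin; rewrite leqNgt ij.
Qed.

Lemma Lambda_expansion (a : nat -> int) n (w : nat -> int) :
  (forall k, (k < n)%N -> w k = 0 \/ w k = a k) ->
  quasi4_expansion a (\sum_(0 <= k < n) 4 ^+ k * w k)
    (fun k => if (k < n)%N then w k else 0).
Proof.
move=> hw; apply/quasi4_expansionP; split.
  by move=> k; case: ifP => [/hw//|_]; left.
exists (fun k => \sum_(k <= i < n) 4 ^+ (i - k) * w i) => [k|]; last first.
  by apply: eq_bigr => i _; rewrite subn0.
have [kn|nk] := ltnP k n; last by rewrite !big_geq // ltnW.
rewrite big_ltn // subnn mul1r mulr_sumr; congr (_ + _).
by apply: eq_big_nat => i /andP[ki _]; rewrite mulrA -exprS -subSn // subSS.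
Qed.

(** A bounded integer orbit visits some value twice; since each term determines
its digit, hence its successor, everything repeats from there on. *)
Lemma orbit_ultimately_periodic {N : nat -> int} {w B} (f : int -> int) :
  residuals N w -> (forall k, w k = f (N k)) -> (forall k, (`|N k| <= B)%N) ->
  ultimately_periodic w.
Proof.
move=> hN hf hB.
have [i [j [ij Nij]]] : exists i j, (i < j)%N /\ N i = N j.
  (* Pigeonhole: 2 B + 2 indices for the 2 B + 1 integers in [- B, B]. *)
  pose h (k : 'I_((B.*2).+2)) : 'I_((B.*2).+1) := inord (absz (N k + B%:Z)).
  have : ~~ injectiveb h.
    apply/negP => /injectiveP/leq_card; rewrite !card_ord; lia.
  move=> /injectivePn[x [y xy /(congr1 val)]].
  rewrite /= !inordK; last 2 first.
  - by have := hB x; have := hB y; lia.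
  - by have := hB x; have := hB y; lia.
  have := hB x; have := hB y => Hy Hx e.
  have {}e : N x = N y by lia.
  have [lt|gt|eq] := ltngtP x y; [by exists x, y|by exists y, x|].
  by move: xy; rewrite (ord_inj eq) eqxx.
have per : forall k, (i <= k)%N -> w (k + (j - i))%N = w k.
  have perN : forall k, N (i + k)%N = N (j + k)%N.
    elim=> [|k IHk]; first by rewrite !addn0.
    have := hN (i + k)%N; have := hN (j + k)%N; rewrite !hf IHk !addnS; lia.
  move=> k ik; rewrite !hf; congr f.
  by rewrite -{2}(subnKC ik) perN; congr N; lia.
exists (mkseq w i), (mkseq (fun k => w (i + k)%N) (j - i)).
rewrite !size_mkseq subn_gt0; split=> // k.
have [ki|ik] := ltnP k i; first by rewrite nth_mkseq.
rewrite nth_mkseq ?ltn_mod ?subn_gt0 //.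
rewrite -{1}(subnKC ik) {1}(divn_eq (k - i) (j - i)).
elim: (_ %/ _)%N => [|c IHc]; first by rewrite mul0n.
by rewrite -IHc -[RHS]per ?leq_addr //; congr w; rewrite mulSn; lia.
Qed.

(** The digit is a function of the residual: it is 0 when 4 divides the residual,
and otherwise p or - p, which are distinct modulo 4. If the digits ended in
zeros, a nonzero residual would be divisible by arbitrarily large powers
of 4. *)
Lemma residuals_expansion {p : int} {a N w} B : odd `|p|%N ->
  (forall k, a k = - p \/ a k = p) -> (forall k, w k = 0 \/ w k = a k) ->
  residuals N w -> (forall k, N k != 0) -> (forall k, (`|N k| <= B)%N) ->
  [/\ quasi4_expansion a (N 0%N) w, ultimately_periodic w & ~ ends_in_zeros w].
Proof.
move=> /odd_int[s es] ha hw hN N0 hB; split.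
- by apply/quasi4_expansionP; split=> //; exists N.
- pose f M : int := if (4 %| M)%Z then 0 else
    if (4 %| M - p)%Z then p else - p.
  apply: (orbit_ultimately_periodic f hN _ hB) => k.
  have wk : w k = 0 \/ w k = p \/ w k = - p.
    by have [] := hw k; have [] := ha k; intuition congruence.
  rewrite /f (hN k); move: (N k.+1) => M; case: wk => [|[]] ->; rewrite es; do ! case: ifP; lia.
- move=> [M hM].
  have e n : N M = 4 ^+ n * N (M + n)%N.
    elim: n => [|n ->]; first by rewrite addn0 mul1r.
    by rewrite (hN (M + n)%N) hM ?leq_addr // add0r mulrA exprSr addnS.
  have := e B; have := N0 (M + B)%N; have := hB M => + NMB eB.
  rewrite eB abszM abszX leqNgt => /negP; apply.
  apply: (leq_trans (ltn_expl B (isT : 1 < 4)%N)).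
  by rewrite leq_pmulr // lt0n absz_eq0.
Qed.

Lemma prepend_zeros {a : nat -> int} {l w} n :
  [/\ quasi4_expansion (fun k => a (n + k)%N) l w,
      ultimately_periodic w & ~ ends_in_zeros w] ->
  exists l' w', [/\ quasi4_expansion a l' w', ultimately_periodic w'
                  & ~ ends_in_zeros w'].
Proof.
elim: n => [|n IHn] in l w *; first by move=> h; exists l, w.
move=> [/quasi4_expansionP[hw [N hN Nl]] [u [v [v0 huv]]] hz].
pose w' k := if k is k'.+1 then w k' else 0.
apply: (IHn (4 * l) w'); split.
- apply/quasi4_expansionP; split=> [[|k]|]; first by left.
    by rewrite addnS; exact: hw.
  exists (fun k => if k is k'.+1 then N k' else 4 * l) => // -[|k] /=.
    by rewrite Nl add0r.
  exact: hN.
- exists (0 :: u), v; split=> // -[//|k] /=.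
  by rewrite huv ltnS subSS.
- by move=> [M hM]; apply: hz; exists M => k Mk; apply: (hM k.+1); rewrite leqW.
Qed.

(** * The random walk driven by the expansions *)

Section Weights.
Local Open Scope classical_set_scope.
Context {R : realType}.
Implicit Types (t x : R).

(** This is cos^2 (pi t / 2), the factor relating the squared Fourier transform of
the Cantor measure at t and at t / 4. *)
Definition wt t : R := (1 + cos (pi * t)) / 2.

Lemma cosD2pi_int t (k : int) : cos (t + 2 * pi * k%:~R) = cos t.
Proof.
have nat_case (s : R) (n : nat) : cos (s + 2 * pi * n%:R) = cos s.
  by rewrite mulr_natr mulr_natl (periodicn (@cosD2pi R)).
case: (intP k) => [|n|n]; rewrite ?mulr0 ?addr0 //; first exact: nat_case.
by rewrite -(nat_case _ n.+1) mulrNz mulrN subrK.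
Qed.

Lemma wtD_even t (k : int) : wt (t + (2 * k)%:~R) = wt t.
Proof.
rewrite /wt; congr ((_ + _) / _); rewrite -(cosD2pi_int (pi * t) k).
by congr cos; rewrite intrM; ring.
Qed.

(** The complementary factor sin^2 (pi t / 2) is again a value of [wt]: the two
branches of the walk have total weight 1. *)
Lemma wtD_odd t (k : int) : wt (t + (2 * k + 1)%:~R) = 1 - wt t.
Proof.
rewrite intrD addrCA addrC wtD_even /wt mulrDr mulr1z mulr1 [_ + pi]addrC.
by rewrite [pi + _]addrC cosDpi; field.
Qed.

Lemma wt_ge0 t : 0 <= wt t.
Proof. by rewrite /wt; have := cos_geN1 (pi * t); lra. Qed.

Lemma wt_le1 t : wt t <= 1.
Proof. by rewrite /wt; have := cos_le1 (pi * t); lra. Qed.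

(** cos (pi t / 2) vanishes only at odd integers. The reduction to |d| <= 1, with
t = d + 2 m + 1, leaves a monotone function of |d|, whence a bound that is
uniform in t. *)
Lemma wt_small (c : R) : 0 < c <= 1 -> exists2 kap : R, 0 < kap &
  forall t, wt t < kap -> exists m : int, `|t - (2 * m + 1)%:~R| <= c.
Proof.
move=> /andP[c0 c1]; have pi0 := @pi_gt0 R.
have piI (s : R) : 0 <= s <= 1 -> pi * s \in `[0, pi]%R.
  by move=> /andP[s0 s1]; rewrite in_itv /= mulr_ge0 ?ler_piMr // ltW.
have picI : pi * c \in `[0, pi]%R by rewrite piI // ltW.
have cosc : cos (pi * c) < 1.
  by rewrite -(@cos0 R) ltr_cos ?mulr_gt0 //; have := piI 0; rewrite mulr0 lexx ler01 => ->.
exists ((1 - cos (pi * c)) / 2); first by rewrite divr_gt0 // subr_gt0.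
move=> t; set m := Num.floor (t / 2); set d := t - (2 * m + 1)%:~R => ht.
exists m; rewrite leNgt; apply/negP => cd; move: ht; apply/negP; rewrite -leNgt.
have dle1 : `|d| <= 1.
  have := floor_itv (t / 2); rewrite -/m intrD /d intrD intrM => /andP[h1 h2].
  by rewrite ler_norml; lra.
have -> : t = d + (2 * m + 1)%:~R by rewrite /d subrK.
rewrite wtD_odd -/d /wt.
have -> : cos (pi * d) = cos (pi * `|d|).
  by case: ger0P => // _; rewrite mulrN cosN.
have : cos (pi * `|d|) <= cos (pi * c).
  apply: ltW; rewrite ltr_cos //; first by rewrite ltr_pM2l.
  by rewrite piI // normr_ge0.
lra.
Qed.

(** Weight of the branch of the walk that starts at t and takes the digit 0
n times. *)
Fixpoint zeros_weight n t := if n is n'.+1 then wt t * zeros_weight n' (t / 4) else 1.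

(** If the product is small, then one of its factors wt (t / 4^j) is small, so
t / 4^j is close to an odd integer and t to 4^j times it. *)
Lemma zeros_weight_small n : exists2 kap : R, 0 < kap &
  forall t, zeros_weight n t < kap -> exists2 N : int, N != 0 & `|t - N%:~R| <= 8^-1.
Proof.
(* At most n multiplications by 4 bring the error c up to 1/8. *)
pose c : R := 8^-1 / 4 ^+ n.
have c4 k : (k <= n)%N -> c * 4 ^+ k <= 8^-1.
  move=> kn; rewrite /c -mulrA ler_piMr // mulrC ler_pdivrMr ?mul1r ?exprn_gt0 //.
  by rewrite ler_weXn2l // ler1n.
have cI : 0 < c <= 1.
  rewrite /c divr_gt0 ?exprn_gt0 //=; have := c4 0%N isT.
  by rewrite expr0 mulr1 /c => /le_trans; apply; lra.
have [kap kap0 hkap] := wt_small c cI.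
exists (kap ^+ n); first exact: exprn_gt0.
suff H k t : (k <= n)%N -> zeros_weight k t < kap ^+ k ->
    exists2 N : int, N != 0 & `|t - N%:~R| <= c * 4 ^+ k.
  by move=> t /(H n t (leqnn n))[N N0 hN]; exists N => //; exact: le_trans (c4 n _).
elim: k t => [|k IHk] t kn /=; first by rewrite expr0 ltxx.
have [/hkap[m hm] _|kt] := ltP (wt t) kap.
  exists (2 * m + 1); first by apply/eqP; lia.
  apply: (le_trans hm); rewrite ler_peMr ?exprn_ege1 ?ler1n //.
  by case/andP: cI => /ltW.
rewrite exprS => lt.
have zw : zeros_weight k (t / 4) < kap ^+ k.
  rewrite -(ltr_pM2l kap0); apply: le_lt_trans lt.
  rewrite ler_wpM2r //; elim: (k) (t / 4) => //= j IHj s.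
  by rewrite mulr_ge0 ?wt_ge0.
have [N N0 hN] := IHk (t / 4) (ltnW kn) zw.
exists (4 * N); first by apply/eqP; move/eqP: N0; lia.
have -> : t - (4 * N)%:~R = 4 * (t / 4 - N%:~R) by rewrite intrM; field.
rewrite normrM ger0_norm // exprS; have := hN; lra.
Qed.

End Weights.

(** An integer within 4/8 + 1/8 of 0 vanishes. *)
Lemma near_int_step {R : realType} {x : R} {d N M : int} :
  `|x - N%:~R| <= 8^-1 -> `|(x - d%:~R) / 4 - M%:~R| <= 8^-1 -> N = d + 4 * M.
Proof.
move=> h1 h2; have : (`|N - d - 4 * M|)%:~R < (1 : R).
  have -> : ((`|N - d - 4 * M|)%:~R : R) =
      `|- (x - N%:~R) + 4 * ((x - d%:~R) / 4 - M%:~R)|.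
    by rewrite intr_norm !intrB intrM; congr `| _ |; field.
  by apply: le_lt_trans (ler_normD _ _) _; rewrite normrN normrM ger0_norm //; lra.
by rewrite ltrz1; lia.
Qed.

Section Walk.
Local Open Scope classical_set_scope.
Context {R : realType}.
Variables (g : R -> R) (p : int) (a : nat -> int).
Hypothesis g_ge0 : forall t, 0 <= g t.
Hypothesis g_le1 : forall t, g t <= 1.
Hypothesis g_scale : forall t, g t = wt t * g (t / 4).
Hypothesis g_near0 : forall eps : R, 0 < eps ->
  exists2 del : R, 0 < del & forall t, `|t| < del -> 1 - eps < g t.
Hypothesis hp : odd `|p|%N.
Hypothesis ha : forall k, a k = - p \/ a k = p.

(** When g t = wt t * g (t / 4), this is the sum of g (t - l) over the 2^n integers
l with n digits taken from a_i, a_(i+1), ... (see [mass_words]), organised by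
the first digit. *)
Fixpoint mass n i t := if n is n'.+1
  then wt t * mass n' i.+1 (t / 4) + (1 - wt t) * mass n' i.+1 ((t - (a i)%:~R) / 4)
  else g t.

Lemma mass_le1 n i t : mass n i t <= 1.
Proof.
elim: n i t => [|n IHn] i t //=.
have := wt_ge0 t; have := wt_le1 t.
have := IHn i.+1 (t / 4); have := IHn i.+1 ((t - (a i)%:~R) / 4); nra.
Qed.

Lemma mass_ge0 n i t : 0 <= mass n i t.
Proof.
elim: n i t => [|n IHn] i t //=.
by rewrite addr_ge0 // mulr_ge0 ?wt_ge0 // subr_ge0 wt_le1.
Qed.

Lemma mass_incr i t : nondecreasing_seq (fun n => mass n i t).
Proof.
apply/nondecreasing_seqP => n; elim: n i t => [|n IHn] i t.
  by rewrite /= g_scale lerDl mulr_ge0 // subr_ge0 wt_le1.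
by rewrite [leRHS]/= [leLHS]/= lerD // ler_wpM2l ?wt_ge0 // subr_ge0 wt_le1.
Qed.

(** Squared distance from the exponential of frequency t to the closed span of
those of frequency in Lambda (a_i, a_(i+1), ...), when g is the squared Fourier
transform. *)
Definition defect i t := 1 - sup (range (fun n => mass n i t)).

Lemma mass_cvg i t : mass n i t @[n --> \oo] --> 1 - defect i t.
Proof.
rewrite /defect subKr; apply: nondecreasing_cvgn; first exact: mass_incr.
by exists 1 => _ [n _ <-]; exact: mass_le1.
Qed.

Lemma mass_le_defect n i t : mass n i t <= 1 - defect i t.
Proof.
rewrite /defect subKr; apply: ub_le_sup; last by exists n.
by exists 1 => _ [m _ <-]; exact: mass_le1.
Qed.

Lemma defect_le1 i t : defect i t <= 1.
Proof. by have := mass_le_defect 0 i t; have := mass_ge0 0 i t; lra. Qed.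

(** Both sides are limits of the recursion that defines [mass]. *)
Lemma defect_harmonic i t : defect i t =
  wt t * defect i.+1 (t / 4) + (1 - wt t) * defect i.+1 ((t - (a i)%:~R) / 4).
Proof.
have h1 : mass n.+1 i t @[n --> \oo] --> 1 - defect i t.
  by have := mass_cvg i t; rewrite -cvg_shiftS.
have h2 : mass n.+1 i t @[n --> \oo] --> wt t * (1 - defect i.+1 (t / 4)) +
    (1 - wt t) * (1 - defect i.+1 ((t - (a i)%:~R) / 4)).
  by apply: cvgD; apply: cvgMl_tmp; exact: mass_cvg.
have e : 1 - defect i t = wt t * (1 - defect i.+1 (t / 4)) +
    (1 - wt t) * (1 - defect i.+1 ((t - (a i)%:~R) / 4)).
  by apply: cvg_unique h1 h2; exact: norm_hausdorff.
by rewrite -[LHS](subKr 1) e; ring.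
Qed.

Section Box.
Variable B : R.
Hypothesis pB : (`|p|%:~R) <= B.

(** (B + B) / 4 <= B: the walk does not leave the interval. *)
Lemma box_step i t : `|t| <= B -> `|t / 4| <= B /\ `|(t - (a i)%:~R) / 4| <= B.
Proof.
have -> : B = (4 * B) / 4 by field.
rewrite !normrM [ `|4^-1|]ger0_norm // !ler_pM2r //.
have aB : `|(a i)%:~R : R| <= B.
  by rewrite -intr_norm; have [->|->] := ha i; rewrite ?normrN.
move=> tB; split; first by have := normr_ge0 t; lra.
by apply: le_trans (ler_normB _ _) _; have := normr_ge0 t; lra.
Qed.

Definition defects := [set y | exists i t, `|t| <= B /\ y = defect i t].

Lemma defect_le_sup i t : `|t| <= B -> defect i t <= sup defects.
Proof.
move=> tB; apply: ub_le_sup; last by exists i, t.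
by exists 1 => _ [j [s [_ ->]]]; exact: defect_le1.
Qed.

(** Unfold the harmonicity n times along the digits 0, bounding the defect on
every other branch by the supremum. *)
Lemma defect_zeros n i t : `|t| <= B -> defect i t <=
  zeros_weight n t * defect (i + n) (t / 4 ^+ n) +
  (1 - zeros_weight n t) * sup defects.
Proof.
elim: n i t => [|n IHn] i t tB /=.
  by rewrite addn0 expr0 divr1 subrr mul1r mul0r addr0.
have [tB4 tB4'] := box_step i t tB.
have -> : t / 4 ^+ n.+1 = (t / 4) / 4 ^+ n by rewrite exprS invfM mulrA.
rewrite defect_harmonic addnS -addSn.
have := IHn i.+1 _ tB4; have := defect_le_sup i.+1 _ tB4'.
set u := defect _ _; set v := defect _ _; set z := zeros_weight _ _.
set y := defect _ _; have := wt_ge0 t; have := wt_le1 t; nra.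
Qed.

End Box.

(** A point where the defect is within eta of its supremum is close to a nonzero
integer, and has a successor with the same property. *)
Lemma defect_expansion t : 0 < defect 0 t -> exists lam w,
  [/\ quasi4_expansion a lam w, ultimately_periodic w & ~ ends_in_zeros w].
Proof.
move=> d0; pose B := Num.max `|t| (`|p|%:~R).
have pB : `|p|%:~R <= B by rewrite le_max lexx orbT.
have tB : `|t| <= B by rewrite le_max lexx.
pose S := sup (defects B).
have S0 : 0 < S by apply: lt_le_trans d0 (defect_le_sup B 0%N t tB).
have [del del0 hdel] := g_near0 _ (divr_gt0 S0 (ltr0n _ 2)).
have [n hn] : exists n, B / 4 ^+ n < del.
  exists (Num.trunc (B / del)).+1.
  rewrite ltr_pdivrMr ?exprn_gt0 // mulrC -ltr_pdivrMr //.
  apply: lt_le_trans (truncnS_gt _) _; rewrite -natrX ler_nat ltnW //.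
  exact: ltn_expl.
have [kap kap0 hkap] := @zeros_weight_small R n.
(* With z the weight of the run of zeros, S - eta < z (S / 2) + (1 - z) S
   gives z < 2 eta / S = kap. *)
pose eta := kap * S / 2.
have eta0 : 0 < eta by rewrite /eta divr_gt0 ?mulr_gt0.
have near_int i x : `|x| <= B -> S - eta < defect i x ->
    exists2 N : int, N != 0 & `|x - N%:~R| <= 8^-1.
  move=> xB ux; apply: hkap.
  have := defect_zeros B pB n i x xB; rewrite -/S.
  have : defect (i + n) (x / 4 ^+ n) < S / 2.
    have /hdel : `|x / 4 ^+ n| < del.
      rewrite normrM normfV [ `|4 ^+ n|]ger0_norm ?exprn_ge0 //.
      by apply: le_lt_trans hn; rewrite ler_pM2r // invr_gt0 exprn_gt0.
    by have := mass_le_defect 0 (i + n) (x / 4 ^+ n) => /=; lra.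
  set z := zeros_weight _ _; set d := defect _ (_ / _).
  have : 0 <= z by rewrite /z; elim: (n) (x) => //= j IHj s; rewrite mulr_ge0 ?wt_ge0.
  move: ux; rewrite /eta; nra.
have [_ [i0 [x0 [x0B ->]]] hx0] : exists2 e, defects B e & S - eta < e.
  apply: sup_adherent => //; split; first by exists (defect 0 t), 0%N, t.
  by exists 1 => _ [j [s [_ ->]]]; exact: defect_le1.
(* Greedy path: take the digit 0 when that keeps the defect large; otherwise
   harmonicity guarantees that the other digit does. *)
pose dig i x : int := if S - eta < defect i.+1 (x / 4) then 0 else a i.
pose next i x := (x - (dig i x)%:~R) / 4.
have next_ok i x : `|x| <= B -> S - eta < defect i x ->
    `|next i x| <= B /\ S - eta < defect i.+1 (next i x).
  move=> xB ux; rewrite /next /dig; have [x4B x4B'] := box_step B pB i x xB.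
  case: ifP => [h|/negbT]; first by rewrite subr0.
  rewrite -leNgt => h; split=> //; move: ux; rewrite defect_harmonic.
  have := wt_ge0 x; have := wt_le1 x; nra.
pose fix xs k := if k is k'.+1 then next (i0 + k')%N (xs k') else x0.
have xs_ok k : `|xs k| <= B /\ S - eta < defect (i0 + k) (xs k).
  by elim: k => [|k [h1 h2]] /=; rewrite ?addn0 ?addnS //; exact: next_ok.
have /choice[N hN] : forall k, exists N : int, N != 0 /\ `|xs k - N%:~R| <= 8^-1.
  by move=> k; have [h1 h2] := xs_ok k; have [M] := near_int _ _ h1 h2; exists M.
pose w k := dig (i0 + k)%N (xs k).
apply: (@prepend_zeros a (N 0%N) w i0).
apply: (@residuals_expansion p _ _ _ (`|Num.floor (B + 2)|%N) hp).
- by move=> k; exact: ha.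
- by move=> k; rewrite /w /dig; case: ifP => _; [left|right].
- move=> k; have [_ h1] := hN k; have [_ h2] := hN k.+1.
  exact: near_int_step h1 h2.
- by move=> k; have [] := hN k.
- move=> k; have [xB _] := xs_ok k; have [_ h] := hN k.
  have : (`|N k|)%:~R <= B + 1.
    have -> : (`|N k|)%:~R = `|xs k - (xs k - (N k)%:~R)|.
      by rewrite subKr intr_norm.
    by apply: le_trans (ler_normB _ _) _; lra.
  move=> hNB; have : (`|N k| <= Num.floor (B + 2)).
    by rewrite floor_ge_int; lra.
  by move=> /le_trans/(_ (ler_norm _)); rewrite -!abszE lez_nat.
Qed.

End Walk.

(** * Square-integrable complex functions *)

Section ComplexIntegral.
Local Open Scope classical_set_scope.
Local Open Scope complex_scope.
Context {d : measure_display} {T : measurableType d} {R : realType}.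
Variable mu : probability T R.
Implicit Types (f g h : T -> R[i]) (c : R[i]).

Definition sqmod (z : R[i]) : R := complex.Re z ^+ 2 + complex.Im z ^+ 2.

Lemma sqmod_ge0 z : 0 <= sqmod z.
Proof. by rewrite addr_ge0 ?sqr_ge0. Qed.

(** Componentwise rules for complex arithmetic, which put expressions in a form
that [ring] and the real measurability lemmas can handle. *)
Lemma cReD (z w : R[i]) : complex.Re (z + w) = complex.Re z + complex.Re w.
Proof. by case: z w => [? ?] []. Qed.
Lemma cImD (z w : R[i]) : complex.Im (z + w) = complex.Im z + complex.Im w.
Proof. by case: z w => [? ?] []. Qed.
Lemma cReM (z w : R[i]) : complex.Re (z * w) =
  complex.Re z * complex.Re w - complex.Im z * complex.Im w.
Proof. by case: z w => [? ?] []. Qed.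
Lemma cImM (z w : R[i]) : complex.Im (z * w) =
  complex.Re z * complex.Im w + complex.Im z * complex.Re w.
Proof. by case: z w => [? ?] []. Qed.

Lemma cReJ (z : R[i]) : complex.Re z^*%R = complex.Re z.
Proof. by case: z. Qed.
Lemma cImJ (z : R[i]) : complex.Im z^*%R = - complex.Im z.
Proof. by case: z. Qed.

Lemma sqmod_conj z : sqmod z^*%R = sqmod z.
Proof. by rewrite /sqmod cReJ cImJ sqrrN. Qed.

Lemma sqmodM z w : sqmod (z * w) = sqmod z * sqmod w.
Proof. by rewrite /sqmod cReM cImM; ring. Qed.

Lemma sqmodD z w : sqmod (z + w) <= 2 * (sqmod z + sqmod w).
Proof.
rewrite /sqmod cReD cImD.
have := sqr_ge0 (complex.Re z - complex.Re w).
have := sqr_ge0 (complex.Im z - complex.Im w); nra.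
Qed.

Lemma mul_conj z : z * z^* = (sqmod z)%:C.
Proof.
case: z => a b; apply/eqP; rewrite eq_complex /sqmod /=.
by apply/andP; split; apply/eqP; ring.
Qed.

(** Square of the L^2 norm, as an integral: unlike the norm it needs no square
roots, and the crude triangle inequality [sqnormD] is enough here. *)
Definition sqnorm f : \bar R := (\int[mu]_x (sqmod (f x))%:E)%E.

Lemma sqnorm_ge0 f : (0 <= sqnorm f)%E.
Proof. by apply: integral_ge0 => x _; rewrite lee_fin sqmod_ge0. Qed.

Lemma L2norm_sqnorm f : L2norm mu f = (sqnorm f `^ 2^-1)%E.
Proof.
rewrite /L2norm unlock; congr (_ `^ _)%E; apply: eq_integral => x _ /=.
rewrite powR_mulrn // /sqmod; congr EFin; case: (f x) => a b /=.
by rewrite ger0_norm ?sqrtr_ge0 // sqr_sqrtr // addr_ge0 ?sqr_ge0.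
Qed.

Lemma L2norm_lty f : (L2norm mu f < +oo)%E <-> (sqnorm f < +oo)%E.
Proof.
rewrite L2norm_sqnorm; split; last exact: poweR_lty.
by apply: lty_poweRy; rewrite invr_neq0.
Qed.

Lemma L2norm_lt f eps : 0 < eps ->
  (L2norm mu f < eps%:E)%E <-> (sqnorm f < (eps ^+ 2)%:E)%E.
Proof.
move=> e0; rewrite L2norm_sqnorm; have := sqnorm_ge0 f.
case: (sqnorm f) => [r| |] // r0; last by rewrite poweRyr ?invr_neq0.
rewrite poweR_EFin !lte_fin powR12_sqrt // -(ltr_pXn2r (_ : 0 < 2)%N) ?nnegrE ?sqrtr_ge0 ?ltW //.
by rewrite sqr_sqrtr.
Qed.

Lemma cmeasurableD f g : cmeasurable f -> cmeasurable g ->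
  cmeasurable (fun x => f x + g x).
Proof.
move=> [f1 f2] [g1 g2]; split.
  by under eq_fun do rewrite cReD; exact: measurable_funD.
by under eq_fun do rewrite cImD; exact: measurable_funD.
Qed.

Lemma cmeasurableM f g : cmeasurable f -> cmeasurable g ->
  cmeasurable (fun x => f x * g x).
Proof.
move=> [f1 f2] [g1 g2]; split.
  under eq_fun do rewrite cReM.
  by apply: measurable_funB; exact: measurable_funM.
under eq_fun do rewrite cImM.
by apply: measurable_funD; exact: measurable_funM.
Qed.

Lemma cmeasurable_cst c : cmeasurable (fun _ : T => c).
Proof. by split; exact: measurable_cst. Qed.

Lemma cmeasurableZ c f : cmeasurable f -> cmeasurable (fun x => c * f x).
Proof. exact/cmeasurableM/cmeasurable_cst. Qed.

Lemma cmeasurable_sum (I : Type) (s : seq I) (F : I -> T -> R[i]) :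
  (forall i, cmeasurable (F i)) -> cmeasurable (fun x => \sum_(i <- s) F i x).
Proof.
move=> mF; elim: s => [|i s IHs].
  by under eq_fun do rewrite big_nil; exact: cmeasurable_cst.
by under eq_fun do rewrite big_cons; exact: cmeasurableD.
Qed.

Lemma cmeasurableB f g : cmeasurable f -> cmeasurable g ->
  cmeasurable (fun x => f x - g x).
Proof.
move=> mf mg; under eq_fun do rewrite -mulN1r.
by apply: cmeasurableD => //; exact: cmeasurableZ.
Qed.

Lemma cmeasurable_conj f : cmeasurable f -> cmeasurable (fun x => (f x)^*%R).
Proof.
move=> [f1 f2]; split; first by under eq_fun do rewrite cReJ.
by under eq_fun do rewrite cImJ; exact: measurable_funN.
Qed.

Lemma cmeasurable_real (f : T -> R) : measurable_fun [set: T] f ->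
  cmeasurable (fun x => (f x)%:C).
Proof. by move=> mf; split=> //=; exact: measurable_cst. Qed.

Lemma measurable_sqmod f : cmeasurable f -> measurable_fun [set: T] (fun x => (sqmod (f x))%:E).
Proof.
move=> [f1 f2]; apply/measurable_EFinP.
by apply: measurable_funD; apply: measurable_funX.
Qed.

Lemma sqnormD f g : cmeasurable f -> cmeasurable g ->
  (sqnorm (fun x => f x + g x)%R <= 2%:E * (sqnorm f + sqnorm g))%E.
Proof.
move=> mf mg; rewrite /sqnorm -ge0_integralD //; do ?
  [exact: measurable_sqmod|by move=> x _; rewrite lee_fin sqmod_ge0].
rewrite -ge0_integralZl //; last first.
- by move=> x _; rewrite -EFinD lee_fin addr_ge0 ?sqmod_ge0.
- by apply: emeasurable_funD; exact: measurable_sqmod.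
apply: ge0_le_integral => //.
- by move=> x _; rewrite lee_fin sqmod_ge0.
- by apply: measurable_sqmod; exact: cmeasurableD.
- apply: measurable_funeM; by apply: emeasurable_funD; exact: measurable_sqmod.
- by move=> x _; rewrite -EFinD -EFinM lee_fin sqmodD.
Qed.

Lemma sqnormZ c f : cmeasurable f ->
  (sqnorm (fun x => c * f x)%R = (sqmod c)%:E * sqnorm f)%E.
Proof.
move=> mf; rewrite /sqnorm -ge0_integralZl //.
- by apply: eq_integral => x _; rewrite sqmodM EFinM.
- exact: measurable_sqmod.
- by move=> x _; rewrite lee_fin sqmod_ge0.
- by rewrite lee_fin sqmod_ge0.
Qed.

(** Bounded measurable functions form an algebra, closed under conjugation, on
which the integral is linear; all inner products below are taken in it. *)
Definition bmeasurable f := cmeasurable f /\ exists M, forall x, sqmod (f x) <= M.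

Lemma bmeasurableD f g : bmeasurable f -> bmeasurable g ->
  bmeasurable (fun x => f x + g x).
Proof.
move=> [mf [M hM]] [mg [N hN]]; split; first exact: cmeasurableD.
by exists (2 * (M + N)) => x; apply: le_trans (sqmodD _ _) _; rewrite ler_pM2l // lerD.
Qed.

Lemma bmeasurableM f g : bmeasurable f -> bmeasurable g ->
  bmeasurable (fun x => f x * g x).
Proof.
move=> [mf [M hM]] [mg [N hN]]; split; first exact: cmeasurableM.
by exists (M * N) => x; rewrite sqmodM ler_pM ?sqmod_ge0.
Qed.

Lemma bmeasurable_cst c : bmeasurable (fun _ => c).
Proof. by split; [exact: cmeasurable_cst|exists (sqmod c)]. Qed.

Lemma bmeasurableZ c f : bmeasurable f -> bmeasurable (fun x => c * f x).
Proof. exact/bmeasurableM/bmeasurable_cst. Qed.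

Lemma bmeasurableB f g : bmeasurable f -> bmeasurable g ->
  bmeasurable (fun x => f x - g x).
Proof.
move=> mf mg; under eq_fun do rewrite -mulN1r.
by apply: bmeasurableD => //; exact: bmeasurableZ.
Qed.

Lemma bmeasurable_conj f : bmeasurable f -> bmeasurable (fun x => (f x)^*%R).
Proof.
move=> [mf [M hM]]; split; first exact: cmeasurable_conj.
by exists M => x; rewrite sqmod_conj.
Qed.

Lemma bmeasurable_sum (I : Type) (s : seq I) (F : I -> T -> R[i]) :
  (forall i, bmeasurable (F i)) -> bmeasurable (fun x => \sum_(i <- s) F i x).
Proof.
move=> mF; elim: s => [|i s IHs].
  by under eq_fun do rewrite big_nil; exact: bmeasurable_cst.
by under eq_fun do rewrite big_cons; exact: bmeasurableD.
Qed.

Lemma prob_integral_cst (r : R) : (\int[mu]_x r%:E = r%:E)%E.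
Proof.
transitivity (\int[mu]_x (cst r%:E x))%E; first by [].
by rewrite integral_cst // -[RHS]mule1; congr (_ * _)%E; exact: probability_setT.
Qed.

Lemma bounded_integrable (f : T -> R) M : measurable_fun [set: T] f ->
  (forall x, `|f x| <= M) -> mu.-integrable [set: T] (EFin \o f).
Proof.
move=> mf hM; apply: measurable_bounded_integrable => //.
  by apply: le_lt_trans (probability_le1 mu measurableT) _; rewrite ltry.
by exists M; split; [exact: num_real|move=> M' MM' x _; exact: le_trans (hM x) (ltW MM')].
Qed.

Lemma bmeasurable_integrable f : bmeasurable f ->
  mu.-integrable [set: T] (EFin \o (fun x => complex.Re (f x))) /\
  mu.-integrable [set: T] (EFin \o (fun x => complex.Im (f x))).
Proof.
move=> [[f1 f2] [M hM]]; split; apply: (@bounded_integrable _ (M + 1)) => // x;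
  have := hM x; rewrite /sqmod;
  have := sqr_ge0 (complex.Re (f x)); have := sqr_ge0 (complex.Im (f x));
  rewrite ler_norml; nra.
Qed.

Lemma cintegralD f g : bmeasurable f -> bmeasurable g ->
  cintegral mu (fun x => f x + g x) = cintegral mu f + cintegral mu g.
Proof.
move=> /bmeasurable_integrable[f1 f2] /bmeasurable_integrable[g1 g2].
rewrite /cintegral; apply/eqP; rewrite eq_complex /=; apply/andP; split; apply/eqP.
  by under eq_Rintegral do rewrite cReD; rewrite RintegralD.
by under eq_Rintegral do rewrite cImD; rewrite RintegralD.
Qed.

Lemma cintegralZ c f : bmeasurable f ->
  cintegral mu (fun x => c * f x) = c * cintegral mu f.
Proof.
move=> /bmeasurable_integrable[f1 f2].
rewrite /cintegral; apply/eqP; rewrite eq_complex; case: c => a b /=.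
have iZ k (u : T -> R) : mu.-integrable [set: T] (EFin \o u) ->
    mu.-integrable [set: T] (EFin \o (fun x => k * u x)).
  by move=> iu; exact: (integrableZl measurableT k iu).
apply/andP; split; apply/eqP.
  under eq_Rintegral do rewrite cReM /=.
  by rewrite RintegralB ?RintegralZl //; exact: iZ.
under eq_Rintegral do rewrite cImM /=.
by rewrite RintegralD ?RintegralZl //; exact: iZ.
Qed.

Lemma cintegral_conj f : bmeasurable f ->
  cintegral mu (fun x => (f x)^*%R) = (cintegral mu f)^*%R.
Proof.
move=> /bmeasurable_integrable[f1 f2].
rewrite /cintegral; apply/eqP; rewrite eq_complex; apply/andP; split; apply/eqP.
  by rewrite cReJ; apply: eq_Rintegral => x _; rewrite cReJ.
rewrite cImJ /= -mulN1r -RintegralZl //.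
by apply: eq_Rintegral => x _; rewrite cImJ mulN1r.
Qed.

Lemma L2innerDl f g h : bmeasurable f -> bmeasurable g -> bmeasurable h ->
  L2inner mu (fun x => f x + g x) h = L2inner mu f h + L2inner mu g h.
Proof.
move=> mf mg mh; rewrite /L2inner; under eq_fun do rewrite mulrDl.
by rewrite cintegralD //; apply: bmeasurableM => //; exact: bmeasurable_conj.
Qed.

Lemma L2innerZl c f h : bmeasurable f -> bmeasurable h ->
  L2inner mu (fun x => c * f x) h = c * L2inner mu f h.
Proof.
move=> mf mh; rewrite /L2inner; under eq_fun do rewrite -mulrA.
by rewrite cintegralZ //; apply: bmeasurableM => //; exact: bmeasurable_conj.
Qed.

Lemma L2inner_conj f g : bmeasurable f -> bmeasurable g ->
  L2inner mu f g = (L2inner mu g f)^*%R.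
Proof.
move=> mf mg; rewrite /L2inner -cintegral_conj; last first.
  by apply: bmeasurableM => //; exact: bmeasurable_conj.
by under [in RHS]eq_fun do rewrite rmorphM /= conjCK mulrC.
Qed.

Lemma L2inner_sqnorm f : bmeasurable f -> sqnorm f = (complex.Re (L2inner mu f f))%:E.
Proof.
move=> [mf [M hM]]; rewrite /L2inner /cintegral /= /Rintegral fineK.
  by apply: eq_integral => x _; rewrite mul_conj.
apply: integrable_fin_num => //; apply: (@bounded_integrable _ M).
  under eq_fun do rewrite mul_conj /=.
  exact/measurable_EFinP/measurable_sqmod.
by move=> x; rewrite mul_conj /= ger0_norm ?sqmod_ge0.
Qed.

End ComplexIntegral.

(** * Exponentials, Bessel's identity and the Cantor measure *)

Section SelfSimilar.
Local Open Scope classical_set_scope.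
Local Open Scope complex_scope.
Context {d : measure_display} {T : measurableType d} {R : realType}.
Variables (mu : probability T R) (f1 f2 : {mfun T >-> T}).
Hypothesis mu_half : forall A, measurable A ->
  mu A = ((2^-1)%:E * pushforward mu f1 A + (2^-1)%:E * pushforward mu f2 A)%E.

Lemma ge0_integral_half (f : T -> \bar R) : measurable_fun [set: T] f ->
  (forall x, (0 <= f x)%E) -> (\int[mu]_x f x =
  (2^-1)%:E * \int[mu]_x f (f1 x) + (2^-1)%:E * \int[mu]_x f (f2 x))%E.
Proof.
move=> mf f0; have half_ge0 : 0 <= 2^-1 :> R by rewrite invr_ge0.
pose half := NngNum half_ge0.
rewrite (eq_measure_integral (measure_add (mscale half (pushforward mu f1))
  (mscale half (pushforward mu f2)))); last first.
  by move=> A mA _; rewrite [LHS]mu_half //; exact/esym/measure_addE.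
rewrite ge0_integral_measure_add // !ge0_integral_mscale //.
by rewrite !ge0_integral_pushforward.
Qed.

(** A bounded function becomes nonnegative after adding a constant. *)
Lemma Rintegral_half (f : T -> R) (M : R) : measurable_fun [set: T] f ->
  (forall x, `|f x| <= M) -> \int[mu]_x f x =
  2^-1 * \int[mu]_x f (f1 x) + 2^-1 * \int[mu]_x f (f2 x).
Proof.
move=> mf fM.
have mfk (k : {mfun T >-> T}) : measurable_fun [set: T] (fun x => f (k x)).
  exact: measurableT_comp.
have shift (h : T -> R) : measurable_fun [set: T] h -> (forall x, `|h x| <= M) ->
    (\int[mu]_x (h x + M)%:E = (\int[mu]_x h x + M)%:E)%E.
  move=> mh hM; have ih := bounded_integrable mu _ _ mh hM.
  have iM : mu.-integrable [set: T] (EFin \o cst M).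
    by apply: (bounded_integrable mu _ `|M|) => //; exact: measurable_cst.
  under eq_integral do rewrite EFinD.
  rewrite (integralD measurableT ih iM) [X in (_ + X)%E](prob_integral_cst mu).
  by rewrite EFinD /Rintegral fineK //; apply: integrable_fin_num.
have mfM : measurable_fun [set: T] (fun x => (f x + M)%:E).
  by apply/measurable_EFinP/measurable_funD => //; exact: measurable_cst.
have fM0 x : (0 <= (f x + M)%:E)%E.
  by rewrite lee_fin; have := fM x; rewrite ler_norml; lra.
have := ge0_integral_half _ mfM fM0.
rewrite shift // (shift _ (mfk f1) (fun x => fM _)).
rewrite (shift _ (mfk f2) (fun x => fM _)) -!EFinM -EFinD => -[e].
by apply: (addIr M); rewrite e; field.
Qed.

Lemma cintegral_half f : bmeasurable f -> cintegral mu f =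
  (2^-1)%:C * (cintegral mu (f \o f1) + cintegral mu (f \o f2)).
Proof.
move=> [[mf mf'] [M hM]].
have b x : `|complex.Re (f x)| <= M + 1 /\ `|complex.Im (f x)| <= M + 1.
  have := hM x; rewrite /sqmod !ler_norml.
  have := sqr_ge0 (complex.Re (f x)); have := sqr_ge0 (complex.Im (f x)); nra.
rewrite /cintegral; apply/eqP; rewrite eq_complex; apply/andP; split; apply/eqP.
  rewrite cReM /= (Rintegral_half _ (M + 1)) //; last by move=> x; case: (b x).
  by rewrite mul0r subr0 mulrDr.
rewrite cImM /= (Rintegral_half _ (M + 1)) //; last by move=> x; case: (b x).
by rewrite mul0r addr0 mulrDr.
Qed.

End SelfSimilar.

Section Fourier.
Local Open Scope classical_set_scope.
Local Open Scope complex_scope.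
Context {R : realType}.
Implicit Types (r t : R) (s : seq R).
Local Notation T := (measurableTypeR R).

Lemma expiD r t (x : T) : expi (r + t) x = expi r x * expi t x.
Proof.
rewrite /expi; apply/eqP; rewrite eq_complex cReM cImM /=.
rewrite (mulrDr (2 * pi)) mulrDl cosD sinD eqxx /=.
by rewrite [X in _ == X]addrC.
Qed.

Lemma expi0 (x : T) : expi 0 x = 1.
Proof. by rewrite /expi mulr0 mul0r cos0 sin0. Qed.

Lemma expi_conj t (x : T) : (expi t x)^*%R = expi (- t) x.
Proof.
by apply/eqP; rewrite eq_complex cReJ cImJ /= mulrN mulNr cosN sinN !eqxx.
Qed.

Lemma sqmod_expi t (x : T) : sqmod (expi t x) = 1.
Proof. by rewrite /sqmod /= cos2Dsin2. Qed.

Lemma bmeasurable_expi t : bmeasurable (@expi R t).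
Proof.
split; last by exists 1 => x; rewrite sqmod_expi.
have mlin : measurable_fun [set: T] (fun x : T => 2 * pi * t * x).
  exact: mulrl_measurable.
split=> /=.
  apply: (@measurableT_comp _ _ _ _ _ _ (@cos R)) mlin.
  by apply: continuous_measurable_fun => x; exact: continuous_cos.
apply: (@measurableT_comp _ _ _ _ _ _ (@sin R)) mlin.
by apply: continuous_measurable_fun => x; exact: continuous_sin.
Qed.

Variable mu : probability T R.

Definition fourier t : R[i] := cintegral mu (expi t).

Lemma L2inner_expi r t : L2inner mu (expi r) (expi t) = fourier (r - t).
Proof.
by rewrite /L2inner; under eq_fun do rewrite expi_conj -expiD.
Qed.

Lemma fourier0 : fourier 0 = 1.
Proof.
rewrite /fourier (_ : expi 0 = cst 1); last exact/funext/expi0.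
have one r : \int[mu]_x r = r by rewrite /Rintegral prob_integral_cst.
by rewrite /cintegral /= !one.
Qed.

Definition power t : R := sqmod (fourier t).

(** Difference between an exponential and its expected orthogonal projection onto
the span of the exponentials with frequencies in s. *)
Definition residue t s (x : T) : R[i] :=
  expi t x - \sum_(l <- s) fourier (t - l) * expi l x.

Lemma bmeasurable_residue t s : bmeasurable (residue t s).
Proof.
apply: bmeasurableB; first exact: bmeasurable_expi.
apply: bmeasurable_sum => l; exact/bmeasurableZ/bmeasurable_expi.
Qed.

Lemma residue_cons t l s x :
  residue t (l :: s) x = residue t s x + - fourier (t - l) * expi l x.
Proof. by rewrite /residue big_cons; ring. Qed.

Lemma residue_inner t s r : (forall l, l \in s -> fourier (l - r) = 0) ->
  L2inner mu (residue t s) (expi r) = fourier (t - r).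
Proof.
elim: s => [|l s IHs] ort.
  by rewrite -L2inner_expi; congr L2inner; apply/funext => x; rewrite /residue big_nil subr0.
rewrite (_ : residue t (l :: s) =
    fun x => residue t s x + - fourier (t - l) * expi l x); last first.
  by apply/funext => x; exact: residue_cons.
have be := bmeasurable_expi; have br := bmeasurable_residue.
rewrite L2innerDl //; last exact: bmeasurableZ.
rewrite L2innerZl // L2inner_expi ort ?mem_head // mulr0 addr0 IHs //.
by move=> k ks; rewrite ort // in_cons ks orbT.
Qed.

(** Adding a frequency l orthogonal to the previous ones lowers the squared norm
by exactly |fourier (t - l)|^2. *)
Lemma bessel t s : uniq s ->
  {in s &, forall l k, l != k -> fourier (l - k) = 0} ->
  L2inner mu (residue t s) (residue t s) = (1 - \sum_(l <- s) power (t - l))%:C.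
Proof.
have be := bmeasurable_expi; have br := bmeasurable_residue.
elim: s => [|l s IHs] /=.
  move=> _ _; rewrite big_nil subr0 (_ : residue t [::] = expi t).
    by rewrite L2inner_expi subrr fourier0.
  by apply/funext => x; rewrite /residue big_nil subr0.
move=> /andP[ls us] ort.
have {}IHs := IHs us (sub_in2 (@mem_behead _ (l :: s)) ort).
have ortl k : k \in s -> fourier (k - l) = 0.
  by move=> ks; rewrite ort ?mem_head ?in_cons ?ks ?orbT //; apply: contraNneq ls => <-.
pose c := fourier (t - l).
rewrite (_ : residue t (l :: s) = fun x => residue t s x + - c * expi l x); last first.
  by apply/funext => x; exact: residue_cons.
have bZ : bmeasurable (fun x => - c * expi l x) by exact: bmeasurableZ.
have bD : bmeasurable (fun x => residue t s x + - c * expi l x) by exact: bmeasurableD.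
have rl : L2inner mu (residue t s) (expi l) = c by exact: residue_inner.
have lr : L2inner mu (expi l) (residue t s) = c^*%R by rewrite L2inner_conj ?rl.
rewrite [LHS]L2innerDl // (L2innerZl mu (- c) (expi l)) //.
rewrite (L2inner_conj mu (residue t s)) // (L2inner_conj mu (expi l)) //.
rewrite !(L2innerDl mu (residue t s)) // !(L2innerZl mu (- c) (expi l)) //.
rewrite IHs rl lr L2inner_expi subrr fourier0.
rewrite big_cons /power -/c /sqmod; case: (c) => a b /=.
by apply/eqP; rewrite eq_complex /=; apply/andP; split; apply/eqP; ring.
Qed.

(** Bessel's inequality for the single frequency 0. *)
Lemma power_le1 t : power t <= 1.
Proof.
have := sqnorm_ge0 mu (residue t [:: 0]).
rewrite L2inner_sqnorm; last exact: bmeasurable_residue.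
rewrite bessel //=; last by move=> l k; rewrite !inE => /eqP-> /eqP->; rewrite eqxx.
by rewrite big_seq1 subr0 lee_fin subr_ge0.
Qed.

End Fourier.

Section Cantor.
Local Open Scope classical_set_scope.
Local Open Scope complex_scope.
Context {R : realType}.
Implicit Types (r t : R) (s : seq R).
Local Notation T := (measurableTypeR R).
Variable mu : probability T R.
Hypothesis hmu : middle_fourth_cantor_measure mu.

Lemma measurable_tau1 : measurable_fun [set: T] (@tau1 R).
Proof. exact: mulrl_measurable. Qed.

Lemma measurable_tau2 : measurable_fun [set: T] (@tau2 R).
Proof.
apply: measurable_funM; first exact: measurable_cst.
by apply: measurable_funD => //; exact: measurable_cst.
Qed.

Let mtau1 : {mfun T >-> T} := HB.pack (@tau1 R) (isMeasurableFun.Build _ _ _ _ _ measurable_tau1).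
Let mtau2 : {mfun T >-> T} := HB.pack (@tau2 R) (isMeasurableFun.Build _ _ _ _ _ measurable_tau2).

(** The two halves of the measure contribute the same integral up to the
phase exp (pi i t), since tau2 is tau1 followed by a translation by 1/2. *)
Lemma fourier_scale t :
  fourier mu t = (2^-1)%:C * (1 + expi t (2^-1 : T)) * fourier mu (t / 4).
Proof.
have be := @bmeasurable_expi R; rewrite /fourier.
rewrite (@cintegral_half _ _ _ mu mtau1 mtau2 hmu) // -mulrA; congr (_ * _).
rewrite mulrDl mul1r; congr (_ + _).
  by congr cintegral; apply/funext => x; rewrite /= /tau1 /expi !mulrA.
rewrite -cintegralZ //; congr cintegral; apply/funext => x.
rewrite /= /expi /tau2; apply/eqP; rewrite eq_complex cReM cImM /=.
have -> : 2 * pi * t * (4^-1 * ((x : R) + 2)) =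
    2 * pi * t * 2^-1 + 2 * pi * (t / 4) * x :> R by field.
by rewrite cosD sinD eqxx /= [X in _ == X]addrC.
Qed.

(** |1 + exp (i y)|^2 / 4 = (1 + cos y) / 2. *)
Lemma power_scale t : power mu t = wt t * power mu (t / 4).
Proof.
rewrite /power fourier_scale !sqmodM; congr (_ * _).
rewrite /sqmod cReD cImD /= /wt.
have -> : 2 * pi * t * 2^-1 = pi * t :> R by field.
have := cos2Dsin2 (pi * t); move: (cos _) (sin _) => c s e.
rewrite add0r; have -> : s ^+ 2 = 1 - c ^+ 2 by rewrite -e; ring.
by rewrite expr0n /=; field.
Qed.

(** wt vanishes at odd integers, and the scaling relation carries the zero to
4^j times such an integer. *)
Lemma fourier_zero j (m : int) : fourier mu (4 ^+ j * (2 * m + 1))%:~R = 0.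
Proof.
suff : power mu (4 ^+ j * (2 * m + 1))%:~R = 0.
  rewrite /power /sqmod; case: (fourier _ _) => u v /=.
  by move/eqP; rewrite paddr_eq0 ?sqr_ge0 // !sqrf_eq0 => /andP[/eqP-> /eqP->].
elim: j => [|j IHj]; rewrite power_scale.
  rewrite expr0 mul1r -[X in wt X]add0r wtD_odd /wt mulr0 cos0.
  by rewrite (_ : 1 - _ = 0) ?mul0r //; field.
rewrite (_ : _ / 4 = (4 ^+ j * (2 * m + 1))%:~R) ?IHj ?mulr0 //.
by rewrite exprS -mulrA intrM; field.
Qed.

Lemma measurable_tail r : measurable [set x : T | r < `|x : R|].
Proof.
have := @normr_measurable R setT measurableT `]r, +oo[%classic (measurable_itv _).
by rewrite setTI; congr measurable; apply/seteqP; split=> x /=; rewrite in_itv /= andbT.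
Qed.

(** If |x / 4| or |(x + 2) / 4| exceeds r >= 1, then |x| > 4 r - 2 >= 2 r; so each
half of the measure has at most the tail of mu beyond 2 r. *)
Lemma cantor_tail r : 1 <= r ->
  (mu [set x : T | (r < `|x : R|)%R] <= mu [set x : T | (2 * r < `|x : R|)%R])%E.
Proof.
move=> r1; have mr := measurable_tail; set A := [set x : T | (2 * r < _)%R].
have half (B : set T) : measurable B -> B `<=` A ->
    ((2^-1)%:E * mu B <= (2^-1)%:E * mu A)%E.
  by move=> mB BA; rewrite lee_wpmul2l ?lee_fin ?invr_ge0 // le_measure ?inE //; exact: mr.
have -> : mu A = ((2^-1)%:E * mu A + (2^-1)%:E * mu A)%E.
  by rewrite -ge0_muleDl ?lee_fin // -EFinD (_ : 2^-1 + 2^-1 = 1) ?mul1e //; field.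
rewrite [leLHS]hmu //; apply: leeD; apply: half.
- by rewrite -[X in measurable X]setTI; apply: measurable_tau1.
- by move=> x; rewrite /A /= /tau1 normrM ger0_norm //; move: `|_| => y; lra.
- by rewrite -[X in measurable X]setTI; apply: measurable_tau2.
- move=> x; rewrite /A /= /tau2 normrM ger0_norm // => h.
  have := ler_normD (x : R) 2; rewrite [ `|2|]ger0_norm //.
  by move: `|_| h => y; move: `|_| => z; lra.
Qed.

(** The tail beyond 1 is at most the tail beyond 2^n, which tends to 0. *)
Lemma cantor_bounded : {ae mu, forall x : T, `|x : R| <= 1}.
Proof.
pose F n := [set x : T | (2 ^+ n < `|x : R|)%R].
have mF n : measurable (F n) by exact: measurable_tail.
have F0 : \bigcap_n F n = set0.
  rewrite -subset0 => x Fx; pose n := (Num.trunc `|x : R|).+1.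
  have := Fx n I; rewrite /F /= ltNge => /negP; apply.
  apply: (le_trans (ltW (truncnS_gt _))); rewrite -/n -natrX ler_nat.
  exact/ltnW/ltn_expl.
exists (F 0%N); split => //; last first.
  by move=> x /= /negP; rewrite -ltNge /F /= expr0.
apply/eqP; rewrite eq_le measure_ge0 andbT.
have : mu (F n) @[n --> \oo] --> mu (\bigcap_n F n).
  apply: nonincreasing_cvg_mu => //.
  - by apply: le_lt_trans (probability_le1 mu (mF _)) _; rewrite ltry.
  - by rewrite F0.
  - move=> n m nm; apply/subsetPset => x; apply: le_lt_trans.
    by rewrite ler_weXn2l // ler1n.
rewrite F0 measure0 => h; apply: cvge_ge h; apply: nearW.
elim=> [//|n IHn]; apply: le_trans IHn _; rewrite /F.
have := cantor_tail (2 ^+ n); rewrite exprS; apply.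
by rewrite exprn_ege1 // ler1n.
Qed.

(** The integrand cos (2 pi t x) is uniformly close to 1 on [-1, 1] when t is
small, and u^2 >= 2 u - 1 transfers this to the square. *)
Lemma power_near0 eps : 0 < eps ->
  exists2 del, 0 < del & forall t, `|t| < del -> 1 - eps < power mu t.
Proof.
move=> e0; have e4 : 0 < eps / 4 by rewrite divr_gt0.
have /cvgrPdist_lt/(_ _ e4) : cos x @[x --> (0 : R)] --> cos 0.
  exact: continuous_cos.
rewrite cos0 near_nbhs => -[/= del del0 hdel].
have pi2 : 0 < 2 * pi :> R by rewrite mulr_gt0 ?pi_gt0.
exists (del / (2 * pi)); first by rewrite divr_gt0.
move=> t; rewrite ltr_pdivlMr // => ht.
have [mcos msin] : cmeasurable (@expi R t) by case: (bmeasurable_expi t).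
have icos : mu.-integrable [set: T] (EFin \o (fun x => cos (2 * pi * t * x))).
  by apply: (bounded_integrable mu _ 1) => // x; rewrite ler_norml cos_geN1 cos_le1.
have : (\int[mu]_x (1 - cos (2 * pi * t * x))%:E <= (eps / 4)%:E)%E.
  rewrite -[leRHS](prob_integral_cst mu); apply: ae_ge0_le_integral => //.
  - apply/measurable_EFinP/measurable_funB => //.
  - by move=> x _; rewrite lee_fin ltW.
  - apply: filterS cantor_bounded => x x1 _; rewrite lee_fin ltW //.
    have /hdel : ball (0 : R) del (2 * pi * t * x).
      rewrite -ball_normE /= sub0r normrN !normrM.
      apply: le_lt_trans ht; rewrite mulrC -normrM (ger0_norm (ltW pi2)).
      by rewrite [_ * `|t|]mulrC ler_piMl // mulr_ge0 // ltW.
    by move=> /=; exact: le_lt_trans (ler_norm _).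
have -> : (\int[mu]_x (1 - cos (2 * pi * t * x))%:E =
    (1 - complex.Re (fourier mu t))%:E)%E.
  have i1 : mu.-integrable [set: T] (EFin \o cst (1 : R)).
    by apply: (bounded_integrable mu _ 1) => // x; rewrite normr1.
  under eq_integral do rewrite EFinB.
  rewrite (integralB measurableT i1 icos) [RHS]EFinB; congr (_ - _)%E.
    exact: prob_integral_cst.
  by rewrite /fourier /cintegral [complex.Re _]/= /Rintegral fineK //; exact: integrable_fin_num.
rewrite lee_fin /power /sqmod; move: (complex.Re _) (complex.Im _) => u v uv.
have := sqr_ge0 (u - 1); have := sqr_ge0 v; nra.
Qed.

End Cantor.

(** * Density of the exponentials *)

Section TrigPolynomials.
Local Open Scope classical_set_scope.
Local Open Scope complex_scope.
Context {R : realType}.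
Local Notation T := (measurableTypeR R).
Implicit Types (l : seq (R * R[i])) (f g : T -> R[i]).

Definition lincomb l (x : T) : R[i] := \sum_(q <- l) q.2 * expi q.1 x.

Lemma cmeasurable_lincomb l : cmeasurable (lincomb l).
Proof.
apply: cmeasurable_sum => q; apply: cmeasurableZ.
by case: (bmeasurable_expi q.1).
Qed.

(** Arbitrary real frequencies are allowed, so that the class is an algebra
containing sin (th (x - c)) for every th and c. *)
Definition trigpoly f := exists l, f =1 lincomb l.

Lemma trigpoly_expi t : trigpoly (expi t).
Proof. by exists [:: (t, 1)] => x; rewrite /lincomb big_seq1 mul1r. Qed.

Lemma trigpolyZ c f : trigpoly f -> trigpoly (fun x => c * f x).
Proof.
move=> [l fl]; exists [seq (q.1, c * q.2) | q <- l] => x.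
rewrite fl /lincomb big_map mulr_sumr.
by apply: eq_bigr => q _; rewrite mulrA.
Qed.

Lemma trigpolyD f g : trigpoly f -> trigpoly g -> trigpoly (fun x => f x + g x).
Proof. by move=> [l fl] [k gk]; exists (l ++ k) => x; rewrite fl gk /lincomb big_cat. Qed.

Lemma trigpolyM f g : trigpoly f -> trigpoly g -> trigpoly (fun x => f x * g x).
Proof.
move=> [l fl] [k gk].
exists [seq (q.1 + r.1, q.2 * r.2) | q <- l, r <- k] => x.
rewrite fl gk /lincomb big_allpairs_dep mulr_suml; apply: eq_bigr => q _.
rewrite mulr_sumr; apply: eq_bigr => r _ /=.
by rewrite expiD mulrACA.
Qed.

Lemma trigpoly_cst c : trigpoly (fun _ => c).
Proof. by exists [:: (0, c)] => x; rewrite /lincomb big_seq1 expi0 mulr1. Qed.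

Lemma trigpoly_sin (th c : R) : trigpoly (fun x : T => (sin (th * ((x : R) - c)))%:C).
Proof.
pose s := th / (2 * pi); pose y := th * c.
have sE (x : T) : 2 * pi * s * x = th * x :> R.
  by rewrite [2 * pi * s]mulrC divfK // mulf_neq0 // gt_eqF // pi_gt0.
have [l hl] := trigpolyD _ _
  (trigpolyZ (2^-1 * sin (- y) -i* (2^-1 * cos y)) _ (trigpoly_expi s))
  (trigpolyZ (2^-1 * sin (- y) +i* (2^-1 * cos y)) _ (trigpoly_expi (- s))).
exists l => x; rewrite -hl mulrBr -/y sinD cosN sinN.
apply/eqP; rewrite eq_complex cReD cImD !cReM !cImM /expi.
rewrite [2 * pi * - s]mulrN [(- (2 * pi * s)) * x]mulNr sE /= cosN sinN.
by apply/andP; split; apply/eqP; field.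
Qed.

End TrigPolynomials.

Section SignIteration.
Local Open Scope classical_set_scope.
Local Open Scope complex_scope.
Context {R : realType}.
Implicit Types z : R.

(** A cubic fixing -1, 0 and 1, for which -1 and 1 attract the rest of
[-1, 1]; its iterates converge pointwise to the sign. *)
Definition sgstep z : R := (3 * z - z ^+ 3) / 2.

Lemma sgstepN z : sgstep (- z) = - sgstep z.
Proof. by rewrite /sgstep; field. Qed.

Lemma iter_sgstepN n z : iter n sgstep (- z) = - iter n sgstep z.
Proof. by elim: n => //= n ->; rewrite sgstepN. Qed.

Lemma iter_sgstep_bounds n z : 0 <= z <= 1 -> z <= iter n sgstep z <= 1.
Proof.
move=> /andP[z0 z1]; elim: n => [|n /andP[h1 h2]] /=; first by rewrite lexx.
move: (iter _ _ _) h1 h2 => y h1 h2; rewrite /sgstep !exprS expr0 mulr1.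
apply/andP; split.
  have : 0 <= y * (1 - y) * (1 + y) by rewrite !mulr_ge0 ?subr_ge0 //; lra.
  nra.
have : 0 <= (1 - y) * (1 - y) * (2 + y) by rewrite !mulr_ge0 ?subr_ge0 //; lra.
nra.
Qed.

Lemma iter_sgstep_norm n z : `|z| <= 1 -> `|iter n sgstep z| <= 1.
Proof.
have H y : 0 <= y <= 1 -> `|iter n sgstep y| <= 1.
  move=> yI; have /andP[h1 h2] := iter_sgstep_bounds n y yI.
  by rewrite ger0_norm //; apply: le_trans h1; case/andP: yI.
have [z0|z0] := ger0P z => z1; first by apply: H; rewrite z0.
by rewrite -[z]opprK iter_sgstepN normrN; apply: H; rewrite oppr_ge0 ltW.
Qed.

(** 1 - sgstep y = (1 - y) (1 - (y + y^2) / 2), and the iterates stay above z, so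
the distance to 1 decreases at least geometrically with ratio 1 - z / 2. *)
Lemma cvg_iter_sgstep z : 0 < z <= 1 -> iter n sgstep z @[n --> \oo] --> (1 : R).
Proof.
move=> /andP[z0 z1]; have zI : 0 <= z <= 1 by rewrite ltW.
pose q := 1 - z / 2.
have q01 : 0 <= q < 1 by rewrite /q; apply/andP; split; lra.
have H n : 1 - iter n sgstep z <= q ^+ n.
  elim: n => [|n IHn] /=; first by rewrite expr0; lra.
  have /andP[h1 h2] := iter_sgstep_bounds n z zI.
  move: IHn h1 h2; rewrite exprS; move: (iter _ _ _) (q ^+ n) => y w IHn h1 h2.
  have e : 1 - sgstep y = (1 - y) * (1 - (y + y * y) / 2) by rewrite /sgstep; field.
  have h3 : (1 - y) * (1 - (y + y * y) / 2) <= (1 - y) * q.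
    by rewrite ler_wpM2l ?subr_ge0 // /q; have := mulr_ge0 (ltW z0) (ltW z0); nra.
  rewrite e (le_trans h3) // mulrC ler_wpM2l //; by case/andP: q01.
have q0 : q ^+ n @[n --> \oo] --> (0 : R).
  by apply: cvg_expr; case/andP: q01 => a b; rewrite ger0_norm.
apply: (@squeeze_cvgr _ _ _ _ (fun n => 1 - q ^+ n) (fun _ => 1)).
- apply: nearW => n; have /andP[_ h2] := iter_sgstep_bounds n z zI.
  by rewrite h2 andbT; have := H n; lra.
- by rewrite -[X in _ --> X]subr0; apply: cvgB => //; exact: cvg_cst.
- exact: cvg_cst.
Qed.

(** (s + s^2) / 2 maps the signs -1, 0, 1 to 0, 0, 1. *)
Definition above_approx n z : R := (iter n sgstep z + iter n sgstep z ^+ 2) / 2.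

Lemma above_approx_norm n z : `|z| <= 1 -> `|above_approx n z| <= 1.
Proof.
move=> /(iter_sgstep_norm n); rewrite /above_approx; move: (iter _ _ _) => y.
rewrite !ler_norml => /andP[h1 h2]; have := sqr_ge0 y.
have : y ^+ 2 <= 1 by rewrite expr2; nra.
by move=> h3 h4; apply/andP; split; lra.
Qed.

Lemma cvg_above_approx z : `|z| <= 1 ->
  above_approx n z @[n --> \oo] --> (if 0 < z then 1 else 0 : R).
Proof.
rewrite ler_norml => /andP[z1 z2].
have sub (y : R) : iter n sgstep z @[n --> \oo] --> y ->
    above_approx n z @[n --> \oo] --> (y + y ^+ 2) / 2.
  move=> hy; apply: cvgMr_tmp; apply: cvgD => //.
  by rewrite expr2; apply: cvgM.
have [z0|z0|z0] := ltgtP 0 z.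
- have -> : (1 : R) = (1 + 1 ^+ 2) / 2 by field.
  by apply: sub; apply: cvg_iter_sgstep; rewrite z0.
- have -> : (0 : R) = (- 1 + (- 1) ^+ 2) / 2 by field.
  apply: sub; rewrite -[z]opprK.
  under eq_fun do rewrite iter_sgstepN.
  by apply: cvgN; apply: cvg_iter_sgstep; apply/andP; split; lra.
- have -> : (0 : R) = (0 + 0 ^+ 2) / 2 by rewrite expr0n addr0 mul0r.
  apply: sub; rewrite -z0.
  rewrite (_ : (fun _ => _) = fun=> 0); first exact: cvg_cst.
  apply/funext => n; elim: n => //= n ->.
  by rewrite /sgstep !exprS; ring.
Qed.

End SignIteration.

Section Density.
Local Open Scope classical_set_scope.
Local Open Scope complex_scope.
Import HBNNSimple.
Context {R : realType}.
Local Notation T := (measurableTypeR R).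
Variables (mu : probability T R) (D : set R).
Implicit Types (f g : T -> R[i]) (u v : T -> R).

(** Membership in the closed linear span, in L^2, of the exponentials with
frequency in D. *)
Definition spanned f := cmeasurable f /\
  forall eps : R, 0 < eps -> exists2 l : seq (R * R[i]),
    (forall q, q \in l -> D q.1) &
    (sqnorm mu (fun x => f x - lincomb l x)%R < eps%:E)%E.

Lemma sqnorm_dist f g h (eps : R) : cmeasurable f -> cmeasurable g -> cmeasurable h ->
  (sqnorm mu (fun x => f x - g x)%R < (eps / 4)%:E)%E ->
  (sqnorm mu (fun x => g x - h x)%R < (eps / 4)%:E)%E ->
  (sqnorm mu (fun x => f x - h x)%R < eps%:E)%E.
Proof.
move=> mf mg mh h1 h2.
rewrite (_ : (fun x => f x - h x) = fun x => (f x - g x) + (g x - h x)); last first.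
  by apply/funext => x; rewrite addrA subrK.
apply: le_lt_trans (sqnormD _ _ _ _ _) _; try exact: cmeasurableB.
have -> : (eps%:E = 2%:E * ((eps / 4)%:E + (eps / 4)%:E))%E.
  by rewrite -EFinD -EFinM; congr EFin; field.
by rewrite lte_pmul2l // lteD.
Qed.

Lemma spanned_lim f : cmeasurable f ->
  (forall eps : R, 0 < eps -> exists2 g, spanned g &
     (sqnorm mu (fun x => f x - g x)%R < eps%:E)%E) -> spanned f.
Proof.
move=> mf hf; split=> // eps e0; have e4 : 0 < eps / 4 by rewrite divr_gt0.
have [g [mg hg] fg] := hf _ e4; have [l lD gl] := hg _ e4.
exists l => //; apply: sqnorm_dist fg gl => //; exact: cmeasurable_lincomb.
Qed.

Lemma spannedD f g : spanned f -> spanned g -> spanned (fun x => f x + g x).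
Proof.
move=> [mf hf] [mg hg]; split; first exact: cmeasurableD.
move=> eps e0; have e4 : 0 < eps / 4 by rewrite divr_gt0.
have [l lD fl] := hf _ e4; have [k kD gk] := hg _ e4.
exists (l ++ k) => [q|]; first by rewrite mem_cat => /orP[/lD|/kD].
have ml := cmeasurable_lincomb l; have mk := cmeasurable_lincomb k.
apply: (@sqnorm_dist _ (fun x => lincomb l x + g x)).
- exact: cmeasurableD.
- exact: cmeasurableD.
- exact: cmeasurable_lincomb.
- by under eq_fun do rewrite opprD addrACA subrr addr0.
- by under eq_fun do rewrite /lincomb big_cat /= opprD addrACA subrr add0r.
Qed.

Lemma spannedZ c f : spanned f -> spanned (fun x => c * f x).
Proof.
move=> [mf hf]; split; first exact: cmeasurableZ.
move=> eps e0; have c1 : 0 < sqmod c + 1 by rewrite ltr_wpDl ?sqmod_ge0.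
have [l lD fl] := hf _ (divr_gt0 e0 c1).
exists [seq (q.1, c * q.2) | q <- l]; first by move=> _ /mapP[q /lD qD ->].
have -> : (fun x => c * f x - lincomb [seq (q.1, c * q.2) | q <- l] x) =
    fun x => c * (f x - lincomb l x).
  apply/funext => x; rewrite mulrBr /lincomb big_map mulr_sumr.
  by congr (_ - _); apply: eq_bigr => q _; rewrite mulrA.
have ml := cmeasurable_lincomb l.
rewrite sqnormZ; last exact: cmeasurableB.
have -> : (eps%:E = (sqmod c + 1)%:E * (eps / (sqmod c + 1))%:E)%E.
  by rewrite -EFinM mulrC divfK // gt_eqF.
apply: (@le_lt_trans _ _ ((sqmod c + 1)%:E * sqnorm mu (fun x => (f x - lincomb l x)%R))%E).
  by rewrite lee_wpmul2r ?sqnorm_ge0 // lee_fin lerDl.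
by rewrite lte_pmul2l.
Qed.

Lemma spanned0 : spanned (fun _ => 0).
Proof.
split; first exact: cmeasurable_cst.
move=> eps e0; exists [::] => //; rewrite /sqnorm.
under eq_integral do rewrite /lincomb big_nil subr0 /sqmod /= expr0n /= addr0.
by rewrite prob_integral_cst lte_fin.
Qed.

Definition rspanned u := spanned (fun x => (u x)%:C).

Lemma rspannedD u v : rspanned u -> rspanned v -> rspanned (fun x => u x + v x).
Proof.
move=> hu hv; have := spannedD _ _ hu hv.
by under eq_fun do rewrite -rmorphD.
Qed.

Lemma rspannedZ (c : R) u : rspanned u -> rspanned (fun x => c * u x).
Proof.
move=> hu; have := spannedZ c%:C _ hu.
by under eq_fun do rewrite -rmorphM.
Qed.

Lemma rspanned_sum (I : Type) (s : seq I) (F : I -> T -> R) :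
  (forall i, rspanned (F i)) -> rspanned (fun x => \sum_(i <- s) F i x).
Proof.
move=> hF; elim: s => [|i s IHs].
  by under eq_fun do rewrite big_nil; exact: spanned0.
by under eq_fun do rewrite big_cons; exact: rspannedD.
Qed.

Lemma sqmod_real (a : R) : sqmod a%:C = a ^+ 2.
Proof. by rewrite /sqmod /= expr0n /= addr0. Qed.

(** The closed span is closed under dominated convergence. This is the only
limit process that the density argument needs. *)
Lemma rspanned_dominated u v (F : nat -> T -> R) :
  measurable_fun [set: T] u -> (forall n, rspanned (F n)) ->
  mu.-integrable [set: T] (fun x => (v x ^+ 2)%:E) ->
  (forall n x, `|F n x - u x| <= v x) ->
  {ae mu, forall x, F n x @[n --> \oo] --> u x} -> rspanned u.
Proof.
move=> mu_ hF iv Fv cF; apply: spanned_lim; first exact: cmeasurable_real.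
have mF n : measurable_fun [set: T] (F n) by case: (hF n) => -[].
pose G n x : \bar R := ((F n x - u x) ^+ 2)%:E.
have mG n : measurable_fun [set: T] (G n).
  by apply/measurable_EFinP/measurable_funX/measurable_funB.
have G0 : {ae mu, forall x, [set: T] x -> G n x @[n --> \oo] --> cst 0%E x}.
  apply: filterS cF => x Fx _; apply: cvg_EFin; first exact: nearW.
  have Fu : F n x - u x @[n --> \oo] --> (0 : R).
    by rewrite -[X in _ --> X](subrr (u x)); apply: cvgB => //; exact: cvg_cst.
  by rewrite /= -[X in _ --> X](mulr0 0); apply: cvgM.
have Gv : {ae mu, forall x n, [set: T] x -> (`|G n x| <= (v x ^+ 2)%:E)%E}.
  apply/aeW => x n _; rewrite /G /= lee_fin ger0_norm ?sqr_ge0 //.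
  by rewrite -real_normK ?num_real // lerXn2r ?nnegrE // (le_trans _ (Fv n x)).
have [_ _] := dominated_convergence measurableT mG (measurable_cst _) G0 iv Gv.
rewrite integral0 => cG eps e0.
have /filter_ex[n hn] : \forall n \near \oo, (\int[mu]_x G n x < eps%:E)%E.
  by have := cG [set y | (y < eps%:E)%E] (@open_ereal_lt' R 0%E eps%:E e0).
exists (fun x => (F n x)%:C); first exact: hF.
apply: le_lt_trans hn.
rewrite /sqnorm le_eqVlt; apply/orP; left; apply/eqP; apply: eq_integral => x _.
by rewrite -rmorphB sqmod_real /G -sqrrN opprB.
Qed.

Lemma rspanned_bounded u (M : R) (F : nat -> T -> R) :
  measurable_fun [set: T] u -> (forall n, rspanned (F n)) ->
  (forall n x, `|F n x| <= M) -> (forall x, `|u x| <= M) ->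
  {ae mu, forall x, F n x @[n --> \oo] --> u x} -> rspanned u.
Proof.
move=> mu_ hF FM uM; apply: (rspanned_dominated _ (cst (2 * M))) => //.
  by apply: (@bounded_integrable _ _ _ mu (cst ((2 * M) ^+ 2)) `|(2 * M) ^+ 2|).
move=> n x /=; apply: le_trans (ler_normB _ _) _.
by have := FM n x; have := uM x; lra.
Qed.

Hypothesis mu_bounded : {ae mu, forall x : T, `|x : R| <= 1}.
Hypothesis expi_spanned : forall t, spanned (expi t).

Lemma trigpoly_spanned f : trigpoly f -> spanned f.
Proof.
move=> [l fl]; rewrite (_ : f = lincomb l); last exact/funext.
elim: l {f fl} => [|q l IHl].
  by rewrite (_ : lincomb [::] = fun=> 0); [exact: spanned0|apply/funext => x; exact: big_nil].
rewrite (_ : lincomb (q :: l) = fun x => q.2 * expi q.1 x + lincomb l x).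
  exact/spannedD/IHl/spannedZ.
by apply/funext => x; exact: big_cons.
Qed.

(** For th (1 + |c|) = 1 and |x| <= 1, the number th (x - c) lies in ]-pi, pi[,
where the sine has the sign of its argument. *)
Lemma rspanned_ray (c : R) : rspanned (\1_(`]c, +oo[%classic : set T)).
Proof.
(* Any frequency with th (1 + |c|) < pi would do. *)
pose th : R := (1 + `|c|)^-1; have th0 : 0 < th by rewrite invr_gt0 ltr_wpDr.
pose z (x : T) := sin (th * ((x : R) - c)).
have zle x : `|z x| <= 1 by rewrite ler_norml sin_geN1 sin_le1.
apply: (rspanned_bounded _ 1 (fun n x => above_approx n (z x))).
- by apply: measurable_indic; exact: measurable_itv.
- have zt : trigpoly (fun x => (z x)%:C) by exact: trigpoly_sin.
  have it n : trigpoly (fun x => (iter n sgstep (z x))%:C).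
    elim: n => [//|n IHn].
    rewrite (_ : (fun _ => _) = fun x => (3 / 2)%:C * (iter n sgstep (z x))%:C +
      (- 2^-1)%:C * ((iter n sgstep (z x))%:C *
        ((iter n sgstep (z x))%:C * (iter n sgstep (z x))%:C))).
      by apply: trigpolyD; apply: trigpolyZ => //; apply: trigpolyM => //; exact: trigpolyM.
    apply/funext => x; rewrite -!rmorphM -rmorphD; congr (_%:C).
    by rewrite /= /sgstep !exprS; field.
  move=> n; apply: trigpoly_spanned.
  rewrite (_ : (fun _ => _) = fun x => (2^-1)%:C * ((iter n sgstep (z x))%:C +
      (iter n sgstep (z x))%:C * (iter n sgstep (z x))%:C)).
    by apply: trigpolyZ; apply: trigpolyD => //; exact: trigpolyM.
  apply/funext => x; rewrite -!rmorphM -rmorphD -rmorphM; congr (_%:C).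
  by rewrite /above_approx expr2 mulrC.
- by move=> n x; exact: above_approx_norm.
- by move=> x; rewrite indicE; case: (_ \in _); rewrite ?normr1 ?normr0.
- apply: filterS mu_bounded => x x1.
  have -> : \1_(`]c, +oo[%classic : set T) x = if 0 < z x then 1 else 0 :> R; last first.
    exact: cvg_above_approx.
  have small : `|th * ((x : R) - c)| < pi.
    rewrite normrM gtr0_norm // /th mulrC ltr_pdivrMr ?ltr_wpDr //.
    apply: (@le_lt_trans _ _ (1 + `|c|)).
      by apply: le_trans (ler_normB _ _) _; rewrite lerD2r.
    rewrite ltr_pMl; first by apply: lt_le_trans (@pi_ge2 R); lra.
    by rewrite ltr_wpDr.
  have cx : (0 < z x) = (c < x :> R).
    rewrite -[RHS]subr_gt0 -(pmulr_rgt0 _ th0) /z.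
    move: (th * _) small => y; rewrite ltr_norml => /andP[y1 y2].
    apply/idP/idP => [|y0]; last by apply: sin_gt0_pi; rewrite y0.
    apply: contraLR; rewrite -!leNgt => y0.
    by rewrite -oppr_ge0 -sinN sin_ge0_pi // oppr_ge0 y0 /=; lra.
  rewrite cx indicE; case: (boolP (c < x)) => h.
    by rewrite mem_set //= in_itv /= andbT.
  by rewrite memNset //= in_itv /= andbT; exact/negP.
Qed.

Lemma indic_bound (A : set T) x : `|\1_A x : R| <= 1.
Proof. by rewrite indicE; case: (_ \in _); rewrite ?normr1 ?normr0. Qed.

(** The rays form a pi-system generating the Borel sets, and the sets whose
indicator lies in the closed span form a Dynkin system. *)
Lemma rspanned_indic (A : set T) : measurable A -> rspanned (\1_A).
Proof.
have cst1 : rspanned (fun _ => 1).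
  apply: trigpoly_spanned; exact: trigpoly_cst.
move=> mA; have mE : (@measurable _ T) = <<s @RGenOInfty.G R >>.
  exact: RGenOInfty.measurableE.
move: mA; rewrite [in X in X -> _]mE.
apply: (dynkin_induction (P := fun A => rspanned (\1_A)) mE).
- move=> _ _ [x ->] [y ->]; exists (Num.max x y); apply/seteqP; split=> z /=;
  by rewrite !in_itv /= !andbT gt_max => /andP.
- by rewrite indicT.
- by move=> _ [x ->]; exact: rspanned_ray.
- move=> A' _ hA.
  rewrite (_ : \1_(~` A') = fun x => 1 + (-1) * \1_A' x).
    exact/rspannedD/rspannedZ.
  by apply/funext => x; rewrite !indicE in_setC; case: (_ \in _) => /=; ring.
- move=> F mF tF hF.
  (* Countable disjoint unions are limits of their finite parts. *)
  pose S n := \big[setU/set0]_(i < n) F i.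
  have hS n : rspanned (\1_(S n)).
    rewrite (_ : \1_(S n) = fun x => \sum_(i <- index_iota 0 n) \1_(F i) x).
      exact: rspanned_sum.
    elim: n => [|n IHn]; apply/funext => x.
      by rewrite /S big_ord0 big_nil indic0.
    rewrite big_nat_recr //= -[X in X + _]/((fun x => _) x) -IHn /S big_ord_recr /= -/(S n).
    rewrite !indicE in_setU; have [xS|xS] := boolP (x \in S n); last first.
      by rewrite /= add0r.
    rewrite (_ : (x \in F n) = false) ?addr0 //.
    apply/negP; rewrite inE => xF; move: xS; rewrite inE /S -bigcup_mkord.
    move=> [i /= ni xi].
    by have := tF i n I I (ex_intro _ x (conj xi xF)) => e; move: ni; rewrite /= e ltnn.
  apply: (rspanned_bounded _ 1 (fun n => \1_(S n))) => //.
  + apply: measurable_indic; exact: bigcupT_measurable.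
  + by move=> n x; exact: indic_bound.
  + by move=> x; exact: indic_bound.
  apply: aeW => x; rewrite indicE.
  have [[k _ Fkx]|nx] := pselect ((\bigcup_k F k) x).
    rewrite mem_set; last by exists k.
    apply: cvg_near_cst; exists k.+1 => // n /= kn.
    by rewrite indicE mem_set // /S -bigcup_mkord; exists k.
  rewrite memNset //; apply: cvg_near_cst; apply: nearW => n.
  rewrite indicE memNset //= /S -bigcup_mkord => -[i _ Fix]; apply: nx.
  by exists i.
Qed.

Lemma rspanned_nnsfun (phi : {nnsfun T >-> R}) : rspanned phi.
Proof.
rewrite (_ : (phi : T -> R) = fun x =>
    \sum_(y <- fset_set (range phi)) y * \1_(phi @^-1` [set y]) x).
  apply: rspanned_sum => y; apply/rspannedZ/rspanned_indic.
  exact: measurable_sfunP.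
apply/funext => x; rewrite fimfunE fsbig_finite //; exact: fimfunP.
Qed.

(** Monotone approximation by simple functions, dominated by the function
itself. *)
Lemma rspanned_ge0 u : measurable_fun [set: T] u -> (forall x, 0 <= u x) ->
  mu.-integrable [set: T] (fun x => (u x ^+ 2)%:E) -> rspanned u.
Proof.
move=> mu_ u0 iu.
have mEu : measurable_fun [set: T] (EFin \o u) by exact/measurable_EFinP.
have Eu0 x : [set: T] x -> (0 <= (EFin \o u) x)%E by move=> _; rewrite lee_fin.
have cphi x := cvg_nnsfun_approx measurableT mEu Eu0 (I : [set: T] x).
apply: (rspanned_dominated u u (nnsfun_approx measurableT mEu)) => //.
- by move=> n; exact: rspanned_nnsfun.
- move=> n x; rewrite ler0_norm; last first.
    by rewrite subr_le0 -lee_fin; rewrite nnsfun_approxE; exact: (le_approx n Eu0).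
  by rewrite opprB lerBlDr lerDl.
- by apply: aeW => x; have /fine_cvgP[_] := cphi x.
Qed.

(** Split into positive and negative parts of the real and imaginary parts. *)
Lemma L2_spanned f : L2 mu f -> spanned f.
Proof.
move=> [[mf1 mf2] /L2norm_lty fin].
have isq (u : T -> R) : measurable_fun [set: T] u ->
    (forall x, u x ^+ 2 <= sqmod (f x)) ->
    mu.-integrable [set: T] (fun x => (u x ^+ 2)%:E).
  move=> mu_ usq; apply/integrableP; split.
    by apply/measurable_EFinP/measurable_funX.
  apply: le_lt_trans fin; apply: ge0_le_integral => //.
  - by apply: measurableT_comp => //; apply/measurable_EFinP/measurable_funX.
  - exact: measurable_sqmod.
  - by move=> x _; rewrite /= lee_fin ger0_norm ?sqr_ge0.
have parts (u : T -> R) : measurable_fun [set: T] u ->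
    (forall x, u x ^+ 2 <= sqmod (f x)) -> rspanned u.
  move=> mu_ usq.
  rewrite (_ : u = fun x => u^\+ x + (-1) * u^\- x).
    apply: rspannedD; last apply: rspannedZ; apply: rspanned_ge0 => //.
    - exact: measurable_funrpos.
    - apply: isq; first exact: measurable_funrpos.
      move=> x; apply: le_trans (usq x).
      by rewrite /funrpos; case: (leP (u x) 0) => // _; rewrite expr0n /= sqr_ge0.
    - exact: measurable_funrneg.
    - apply: isq; first exact: measurable_funrneg.
      move=> x; apply: le_trans (usq x).
      by rewrite /funrneg; case: (leP (- u x) 0) => // _; rewrite ?sqrrN // expr0n /= sqr_ge0.
  apply/funext => x; rewrite mulN1r /funrpos /funrneg.
  by case: (leP (u x) 0); case: (leP (- u x) 0); lra.
have Re_sp : rspanned (fun x => complex.Re (f x)).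
  by apply: parts => // x; rewrite /sqmod lerDl sqr_ge0.
have Im_sp : rspanned (fun x => complex.Im (f x)).
  by apply: parts => // x; rewrite /sqmod lerDr sqr_ge0.
rewrite (_ : f = fun x => (complex.Re (f x))%:C + 'i * (complex.Im (f x))%:C).
  exact/spannedD/spannedZ.
by apply/funext => x; exact: complexE.
Qed.

End Density.

(** * Spectrality *)

Section Spectrum.
Local Open Scope classical_set_scope.
Local Open Scope complex_scope.
Context {R : realType}.
Local Notation T := (measurableTypeR R).
Variables (mu : probability T R) (p : int) (a : nat -> int).
Hypothesis hmu : middle_fourth_cantor_measure mu.
Hypothesis hp : odd `|p|%N.
Hypothesis ha : forall k, a k = - p \/ a k = p.

(** The integers sum_(k < n) 4^k w_k with w_k in {0, a_(i+k)}, listed by their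
first digit so as to follow the recursion of [mass]. *)
Fixpoint words (n i : nat) : seq int := if n is n'.+1
  then [seq 4 * l | l <- words n' i.+1] ++ [seq a i + 4 * l | l <- words n' i.+1]
  else [:: 0].

Lemma odd_digit i : exists s, a i = 2 * s + 1.
Proof.
have [s es] := odd_int _ hp; case: (ha i) => ->; first by exists (- s - 1); lia.
by exists s.
Qed.

(** The two halves have different parities. *)
Lemma words_uniq n i : uniq (words n i).
Proof.
elim: n i => [//|n IHn] i /=; rewrite cat_uniq !map_inj_uniq ?IHn /=; last 2 first.
- by move=> x y /addrI; apply: mulfI.
- by apply: mulfI.
rewrite andbT; apply/hasPn => _ /mapP[x _ ->]; apply/mapP => -[y _].
by have [s ->] := odd_digit i; lia.
Qed.

(** Translating the words that begin with the odd digit a_i turns wt into 1 - wt,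
and translating by a multiple of 4 leaves wt unchanged. *)
Lemma mass_words n i t : mass (power mu) a n i t =
  \sum_(l <- words n i) power mu (t - l%:~R).
Proof.
elim: n i t => [|n IHn] i t /=; first by rewrite big_seq1 subr0.
have scale s (l : int) : power mu (s - (4 * l)%:~R) = wt s * power mu (s / 4 - l%:~R).
  rewrite (power_scale mu hmu); congr (_ * power _ _); last by rewrite intrM; field.
  by rewrite -(wtD_even s (- (2 * l))); congr wt; rewrite -intrN; congr (_ + _%:~R); lia.
rewrite big_cat !big_map /= !IHn !mulr_sumr; congr (_ + _); apply: eq_bigr => l _.
  by rewrite scale.
rewrite intrD opprD addrA scale; congr (_ * _).
have [s es] := odd_digit i.
by rewrite -intrN (_ : - a i = 2 * (- s - 1) + 1) ?wtD_odd //; lia.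
Qed.

Lemma words_digits n i l : l \in words n i -> exists2 w : nat -> int,
  (forall k, w k = 0 \/ w k = a (i + k)%N) & l = \sum_(0 <= k < n) 4 ^+ k * w k.
Proof.
elim: n i l => [|n IHn] i l /=.
  by rewrite inE => /eqP ->; exists (fun=> 0) => [k|]; [left|rewrite big_nil].
have step d k : d = 0 \/ d = a i -> k \in words n i.+1 -> exists2 w : nat -> int,
    (forall k, w k = 0 \/ w k = a (i + k)%N) &
    d + 4 * k = \sum_(0 <= k < n.+1) 4 ^+ k * w k.
  move=> hd /IHn[w hw ->]; exists (fun j => if j is j'.+1 then w j' else d).
    by move=> [|j]; [rewrite addn0|rewrite addnS -addSn].
  rewrite big_nat_recl // mul1r mulr_sumr; congr (_ + _).
  by apply: eq_bigr => j _; rewrite exprS mulrA.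
rewrite mem_cat => /orP[] /mapP[k kw ->]; last by apply: step => //; right.
by rewrite -[4 * k]add0r; apply: step => //; left.
Qed.

Lemma words_Lambda n l : l \in words n 0 -> Lambda R a l%:~R.
Proof.
move=> /words_digits[w hw ->]; case: n => [|n]; last by exists n.+1, w.
exists 1%N, (fun=> 0); split=> // [k _|]; first by left.
by rewrite big_nil big_nat1 mulr0.
Qed.

Lemma Lambda_int x : Lambda R a x -> exists2 l, x = l%:~R &
  exists2 w, quasi4_expansion a l w & ends_in_zeros w.
Proof.
move=> [n [w [_ hw ->]]]; eexists; first by [].
eexists; first exact: Lambda_expansion hw.
by exists n => k nk; rewrite ltnNge nk.
Qed.

(** Orthogonality of two frequencies: their difference is a power of 4 times an
odd integer. *)
Lemma fourier_expansions l l' w w' : quasi4_expansion a l w ->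
  quasi4_expansion a l' w' -> ~ w =1 w' -> fourier mu (l%:~R - l'%:~R) = 0.
Proof.
move=> hw hw' /existsNP[k /eqP wk]; have [j [m e]] := expansion_neq hp ha hw hw' wk.
by rewrite -intrB e; exact: fourier_zero.
Qed.

Lemma fourier_Lambda x y : Lambda R a x -> Lambda R a y -> x <> y ->
  fourier mu (x - y) = 0.
Proof.
move=> /Lambda_int[l -> [w hw _]] /Lambda_int[l' -> [w' hw' _]] ll'.
apply: (fourier_expansions _ _ _ _ hw hw') => ww'.
by apply: ll'; rewrite (expansion_eq hw hw' ww').
Qed.

(** By Bessel's identity the squared distance to the span of the words of
length n is 1 - mass n, which tends to the defect. *)
Lemma defect0_spanned t : defect (power mu) a 0 t <= 0 ->
  spanned mu (Lambda R a) (expi t).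
Proof.
move=> d0; split; first by case: (bmeasurable_expi t).
move=> eps e0.
have [n hn] : exists n, 1 - eps < mass (power mu) a n 0 t.
  have c := mass_cvg (power mu) a (fun t => sqmod_ge0 _) (power_le1 mu) (power_scale mu hmu) 0 t.
  have lt_lim : 1 - eps < 1 - defect (power mu) a 0 t by lra.
  have /filter_ex[n hn] : \forall n \near \oo, 1 - eps < mass (power mu) a n 0 t.
    exact: cvgr_gt lt_lim.
  by exists n.
pose s : seq R := map intr (words n 0).
exists [seq (l, fourier mu (t - l)) | l <- s].
  by move=> _ /mapP[_ /mapP[l lw ->] ->]; exact: words_Lambda lw.
rewrite (_ : (fun x => _) = residue mu t s); last first.
  by apply/funext => x; rewrite /residue /lincomb big_map.
have us : uniq s.
  by rewrite map_inj_uniq ?words_uniq //; exact: intr_inj.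
rewrite L2inner_sqnorm; last exact: bmeasurable_residue.
rewrite bessel //=; last first.
  move=> _ _ /mapP[l lw ->] /mapP[k kw ->] lk.
  by apply: fourier_Lambda (words_Lambda _ _ lw) (words_Lambda _ _ kw) _; apply/eqP.
by rewrite big_map -mass_words lte_fin; lra.
Qed.

Lemma discrete_Lambda : discrete_set (Lambda R a).
Proof.
apply/seteqP; split; first exact: isolatedS.
move=> x Lx; split; first by rewrite inE.
exists (ball x 2^-1); first exact: nbhsx_ballx.
apply/seteqP; split=> [y [xy Ly]|_ ->]; last by split=> //; exact: ballxx.
have [l lx _] := Lambda_int _ Lx; have [k ky _] := Lambda_int _ Ly.
move: xy; rewrite -ball_normE /= lx ky -intrB -intr_norm => lk.
have : (`|l - k|)%:~R < (1 : R) by apply: lt_trans lk _; lra.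
by rewrite ltrz1 => lk1; congr (_%:~R); lia.
Qed.

Lemma orthonormal_Lambda : orthonormal_family mu (Lambda R a) (@expi R).
Proof.
split=> [x _|x y Lx Ly].
  have be := bmeasurable_expi x; split; first by case: be.
  by apply/L2norm_lty; rewrite L2inner_sqnorm // ltry.
rewrite L2inner_expi; have [->|xy] := eqVneq x y; first by rewrite subrr fourier0.
by apply: fourier_Lambda => //; apply/eqP.
Qed.

(** [dense_span] attaches one coefficient to each frequency, so the coefficients
of repeated frequencies must be added up. *)
Lemma lincomb_undup (l : seq (R * R[i])) (x : T) : lincomb l x =
  \sum_(i <- undup [seq q.1 | q <- l]) (\sum_(q <- l | q.1 == i) q.2) * expi i x.
Proof.
under [RHS]eq_bigr do rewrite mulr_suml big_mkcond.
rewrite exchange_big /lincomb /= big_seq [RHS]big_seq; apply: eq_bigr => q ql.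
rewrite (bigD1_seq q.1) ?undup_uniq ?mem_undup ?map_f //= eqxx big1 ?addr0 //.
by move=> i /negbTE; rewrite eq_sym => ->.
Qed.

Lemma spanned_dense (D : set R) : (forall f, L2 mu f -> spanned mu D f) ->
  dense_span mu D (@expi R).
Proof.
move=> sp f /sp[mf hf] eps e0; have [l lD fl] := hf _ (exprn_gt0 2 e0).
exists (undup [seq q.1 | q <- l]), (fun i => \sum_(q <- l | q.1 == i) q.2); split.
  by move=> x /=; rewrite mem_undup => /mapP[q /lD qD ->].
apply/L2norm_lt => //; move: fl; congr (sqnorm _ _ < _)%E.
by apply/funext => x; rewrite lincomb_undup.
Qed.

(** If P is in the span, then <e - P, e> = 1, and 0 <= |e - P - e|^2 expands to
|e - P|^2 - 1; hence e stays at distance at least 1 from the span. *)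
Lemma orthogonal_not_dense (D : set R) (t : R) :
  (forall x, D x -> fourier mu (x - t) = 0) -> ~ dense_span mu D (@expi R).
Proof.
move=> ort dense; have be := @bmeasurable_expi R.
have Lt : L2 mu (expi t).
  by split; [case: (be t)|apply/L2norm_lty; rewrite L2inner_sqnorm // ltry].
have [s [c [sD]]] := dense _ Lt 1 ltr01.
set P := fun x : T => \sum_(i <- s) c i * expi i x.
have bP : bmeasurable P.
  by apply: bmeasurable_sum => i; exact: bmeasurableZ.
have Pt : L2inner mu P (expi t) = 0.
  have : {subset s <= s} by [].
  rewrite /P {P bP}; elim: {1 3}s => [|i r IHr] rs.
    rewrite (_ : (fun _ => _) = fun x => 0 * expi t x); last first.
      by apply/funext => x; rewrite big_nil mul0r.
    by rewrite L2innerZl // mul0r.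
  rewrite (_ : (fun _ => _) = fun x => c i * expi i x + \sum_(j <- r) c j * expi j x).
    rewrite L2innerDl //; last 2 first.
    - exact: bmeasurableZ.
    - by apply: bmeasurable_sum => j; exact: bmeasurableZ.
    rewrite L2innerZl // L2inner_expi ort ?mulr0 ?add0r; last first.
      by apply: sD; apply: rs; exact: mem_head.
    by apply: IHr => j jr; apply: rs; rewrite in_cons jr orbT.
  by apply/funext => x; rewrite big_cons.
have bN : bmeasurable (fun x => -1 * expi t x) by exact: bmeasurableZ.
have bQ : bmeasurable (fun x => -1 * P x) by exact: bmeasurableZ.
have -> : (fun x => expi t x - P x) = (fun x => expi t x + -1 * P x).
  by apply/funext => x; rewrite mulN1r.
set h := fun x => _; have bh : bmeasurable h by exact: bmeasurableD.
have ht : L2inner mu h (expi t) = 1.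
  by rewrite L2innerDl // L2innerZl // Pt L2inner_expi subrr fourier0 mulr0 addr0.
have th : L2inner mu (expi t) h = 1 by rewrite L2inner_conj // ht rmorph1.
have := sqnorm_ge0 mu (fun x => h x + -1 * expi t x).
have bD : bmeasurable (fun x => h x + -1 * expi t x) by exact: bmeasurableD.
rewrite !L2inner_sqnorm // [X in complex.Re X]L2innerDl // (L2innerZl mu _ (expi t)) //.
rewrite (L2inner_conj mu h) // (L2inner_conj mu (expi t)) //.
rewrite !(L2innerDl mu h) // !(L2innerZl mu _ (expi t)) //.
rewrite ht th L2inner_expi subrr fourier0 lee_fin => le0 /L2norm_lt-/(_ ltr01).
rewrite L2inner_sqnorm // expr1n lte_fin; move: le0.
case: (L2inner mu h h) => u v /=; lra.
Qed.

Lemma Lambda_spectrum : (forall t, defect (power mu) a 0 t <= 0) ->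
  is_spectrum mu (Lambda R a).
Proof.
move=> d0; split; first exact: discrete_Lambda.
split; first exact: orthonormal_Lambda.
apply: spanned_dense => f; apply: L2_spanned; first exact: cantor_bounded.
by move=> t; exact: defect0_spanned.
Qed.

Lemma expansion_not_spectrum lam w : quasi4_expansion a lam w ->
  ~ ends_in_zeros w -> ~ is_spectrum mu (Lambda R a).
Proof.
move=> hw wz [_ [_]]; apply: (@orthogonal_not_dense _ lam%:~R) => x.
move=> /Lambda_int[l -> [v hv [N vN]]].
apply: (fourier_expansions _ _ _ _ hv hw) => vw; apply: wz.
by exists N => k Nk; rewrite -vw vN.
Qed.

End Spectrum.

Theorem theorem4p1 (R : realType)
  (mu4 : probability (measurableTypeR R) R)
  (hmu4 : middle_fourth_cantor_measure mu4)
  (p : int) (hp : odd `|p|%N)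
  (a : nat -> int) (ha : forall k : nat, a k = - p \/ a k = p) :
  ~ is_spectrum mu4 (Lambda R a) <->
  exists (lam : int) (w : nat -> int),
    [/\ quasi4_expansion a lam w, ultimately_periodic w & ~ ends_in_zeros w].
Proof.
split=> [nsp|[lam [w [hw _ wz]]]]; last first.
  exact: (expansion_not_spectrum mu4 p a hmu4 hp ha lam w hw wz).
have [nd|] := pselect (forall t, defect (power mu4) a 0 t <= 0).
  by case: nsp; exact: (Lambda_spectrum mu4 p a hmu4 hp ha nd).
move=> /existsNP[t /negP]; rewrite -ltNge => d0.
apply: (defect_expansion (power mu4) p a) d0 => //.
- by move=> s; exact: sqmod_ge0.
- exact: power_le1.
- exact: power_scale.
- exact: power_near0.
Qed.
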